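(* Let $s\ge 2$ be an integer and let $T_t$ be a tree of order $t$. If either (i) $\ell(T_t)\ge s+1$, or (ii) $t>7(s-2)$, then $$r_{pot}(K_s,T_t)=t+s-2.$$
   Context: All graphs are finite and simple. A sequence of nonnegative integers $\pi=(d_1,\dots,d_n)$ (written in nonincreasing order) is graphic if some graph of order $n$ has degree sequence $\pi$; such a graph is a realization of $\pi$. For a graph $H$, a graphic sequence $\pi$ is potentially $H$-graphic if some realization of $\pi$ contains $H$ as a subgraph. For an $N$-term graphic sequence $\pi=(d_1,\dots,d_N)$, its complementary sequence is $\overline{\pi}=(N-1-d_N,\dots,N-1-d_1)$. For graphs $H_1,H_2$, the potential-Ramsey number $r_{pot}(H_1,H_2)$ is the minimum integer $N$ such that for every $N$-term graphic sequence $\pi$, either $\pi$ is potentially $H_1$-graphic or $\overline{\pi}$ is potentially $H_2$-graphic. $K_s$ denotes the complete graph on $s$ vertices, and $\ell(T)$ denotes the number of leaves (vertices of degree $1$) of a tree $T$. *)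

(* Defs.v *)
From mathcomp Require Import all_boot.
Set Implicit Arguments. Unset Strict Implicit. Unset Printing Implicit Defensive.

Definition simple_graph (V : finType) (e : rel V) : Prop :=
  symmetric e /\ irreflexive e.

Definition deg (V : finType) (e : rel V) (v : V) : nat := #|[set w | e v w]|.

Definition degseq (n : nat) (e : rel 'I_n) : seq nat := [seq deg e i | i <- enum 'I_n].

Definition realizes (pi : seq nat) (G : rel 'I_(size pi)) : Prop :=
  simple_graph G /\ perm_eq pi (degseq G).

Definition graphic (pi : seq nat) : Prop := exists G : rel 'I_(size pi), realizes G.

Definition contains_subgraph (W : finType) (H : rel W) (V : finType) (G : rel V) : Prop :=
  exists f : W -> V, injective f /\ forall x y, H x y -> G (f x) (f y).

Definition potentially_graphic (W : finType) (H : rel W) (pi : seq nat) : Prop :=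
  exists G : rel 'I_(size pi), realizes G /\ contains_subgraph H G.

Definition compl_seq (pi : seq nat) : seq nat :=
  [seq (size pi).-1 - d | d <- rev pi].

Definition rpot_prop (W1 : finType) (H1 : rel W1) (W2 : finType) (H2 : rel W2) (N : nat) : Prop :=
  forall pi : seq nat, size pi = N -> sorted geq pi -> graphic pi ->
    potentially_graphic H1 pi \/ potentially_graphic H2 (compl_seq pi).

Definition rpot_eq (W1 : finType) (H1 : rel W1) (W2 : finType) (H2 : rel W2) (r : nat) : Prop :=
  rpot_prop H1 H2 r /\ forall N, N < r -> ~ rpot_prop H1 H2 N.

Definition complete_graph (s : nat) : rel 'I_s := fun i j => i != j.
Arguments complete_graph s : clear implicits.

Definition connected_graph (V : finType) (e : rel V) : Prop :=
  forall x y : V, connect e x y.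

Definition acyclic_graph (V : finType) (e : rel V) : Prop :=
  forall p : seq V, uniq p -> 3 <= size p -> ~~ cycle e p.

Definition is_tree (V : finType) (e : rel V) : Prop :=
  0 < #|V| /\ simple_graph e /\ connected_graph e /\ acyclic_graph e.

Definition leaves (V : finType) (e : rel V) : nat := #|[set v | deg e v == 1]|.

(* Main.v *)
Require Import Defs.
From mathcomp Require Import all_boot zify.
Set Implicit Arguments. Unset Strict Implicit. Unset Printing Implicit Defensive.

(* Upper bound, by induction on s.  Lay off a vertex v of maximum degree Delta on the vertices
   of largest degree and apply induction to the rest: a tree in its complement is enough, and
   a clique of order s - 1 can be moved into N(v) unless, for some e, at most s - 1 vertices have
   degree > e while at least Delta + 2 have degree >= e.  In that situation
   - if 2s vertices have degree >= s - 2, a realization with K_s is built directly: the excess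
     of the clique is spread evenly over the other vertices, and the remaining demands are
     near-regular, hence graphic;
   - otherwise at least t - s - 1 vertices have complementary degree >= t, and the tree is
     embedded in the complement one vertex after the other, each image being laid off on the
     vertices of largest remaining degree before its children are placed among its neighbours.
     With s + 1 leaves, the non-leaves fit on these vertices; with fewer leaves, an independent
     set of tree vertices is sent elsewhere, which works because N - 1 - Delta, the least
     complementary degree, is large (for s = 3: because the chosen vertices are dominating).
   If fewer than s vertices have degree >= s - 1, the same embedding applies at once.
   Lower bound: the join of K_(s-2) with an edgeless graph. *)

(** * Degree-preserving exchanges on a set of active vertices *)

Definition nb (V : finType) (U : {set V}) (G : rel V) (x : V) : {set V} :=
  [set y in U | G x y].

(** Pairs not inside [U] are frozen, so degrees persist both within [U] and in the whole graph.
    Vertices can thus be processed one at a time, with later exchanges confined to a smaller set. *)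
Definition equideg (V : finType) (U : {set V}) (G G' : rel V) : Prop :=
  [/\ simple_graph G',
      forall x y, ~~ ((x \in U) && (y \in U)) -> G' x y = G x y
    & forall x, x \in U -> #|nb U G' x| = #|nb U G x|].

Lemma equideg_refl (V : finType) (U : {set V}) (G : rel V) :
  simple_graph G -> equideg U G G.
Proof. by []. Qed.

Lemma equideg_trans (V : finType) (U : {set V}) (G1 G2 G3 : rel V) :
  equideg U G1 G2 -> equideg U G2 G3 -> equideg U G1 G3.
Proof.
move=> [_ H12 D12] [s3 H23 D23]; split=> // [x y xy | x xU].
  by rewrite H23 // H12.
by rewrite D23 // D12.
Qed.

Lemma equideg_sub (V : finType) (U U' : {set V}) (G G' : rel V) :
  U' \subset U -> equideg U' G G' -> equideg U G G'.
Proof.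
move=> sU [s' H D]; split=> // [x y xy | x xU].
  by apply: H; apply: contra xy => /andP[/(subsetP sU) -> /(subsetP sU) ->].
have [xU'|xU'] := boolP (x \in U'); last first.
  by congr #|pred_of_set _|; apply/setP=> y; rewrite !inE H // (negbTE xU').
rewrite -(cardsID U' (nb U G' x)) -(cardsID U' (nb U G x)); congr (_ + _).
  have E (K : rel V) : nb U K x :&: U' = nb U' K x.
    apply/setP=> y; rewrite !inE.
    by case: (boolP (y \in U')) => [/(subsetP sU) ->|]; rewrite ?andbF ?andbT.
  by rewrite !E D.
congr #|pred_of_set _|; apply/setP=> y; rewrite !inE.
by case: (boolP (y \in U')) => //= yU'; rewrite H // xU'.
Qed.

(* The pairs joining [a] and [b] to the members of [S] are complemented. *)
Definition toggle (V : finType) (a b : V) (S : {set V}) (G : rel V) : rel V :=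
  fun x y => G x y (+) ((x \in [set a; b]) && (y \in S) || (y \in [set a; b]) && (x \in S)).

(** Each vertex of [S] trades one of [a], [b] for the other. At [a] and at [b], neighbours and
    non-neighbours in [S] change roles, and the two kinds are equally many because [a] and [b] split
    [S] in complementary ways into parts of equal size. *)
Lemma toggle_equideg (V : finType) (U : {set V}) (a b : V) (S : {set V}) (G : rel V) :
  simple_graph G -> a \in U -> b \in U -> a != b -> S \subset U ->
  a \notin S -> b \notin S -> (forall x, x \in S -> G a x = ~~ G b x) ->
  #|[set x in S | G a x]| = #|[set x in S | G b x]| ->
  equideg U G (toggle a b S G).
Proof.
move=> [sG iG] aU bU ab SU aS bS alt cS.
have side c : c \in [set a; b] -> #|[set x in S | G c x]| = #|[set x in S | ~~ G c x]|.
  rewrite !inE => /orP[] /eqP ->.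
    by rewrite cS; apply: eq_card => x; rewrite !inE; case xS: (x \in S); rewrite //= alt // negbK.
  by rewrite -cS; apply: eq_card => x; rewrite !inE; case xS: (x \in S); rewrite //= alt.
split.
- split=> [x y | x].
    by rewrite /toggle sG; congr (_ (+) _); rewrite orbC.
  rewrite /toggle iG addFb orbb; apply/negbTE; apply/negP => /andP[].
  by rewrite !inE => /orP[] /eqP ->; apply/negP.
- move=> x y xy; rewrite /toggle.
  have E u v : ~~ ((u \in U) && (v \in U)) -> (u \in [set a; b]) && (v \in S) = false.
    apply: contraNF => /andP[]; rewrite !inE => /orP[] /eqP -> /(subsetP SU) ->; by rewrite ?aU ?bU.
  by rewrite !E ?addbF // andbC.
move=> x xU.
have [xab | xab] := boolP (x \in [set a; b]).
  have xS : x \in S = false by apply/negbTE; move: xab; rewrite !inE => /orP[] /eqP ->.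
  rewrite -(cardsID S (nb U G x)) -(cardsID S (nb U (toggle a b S G) x)); congr (_ + _).
    transitivity #|[set y in S | ~~ G x y]|.
      apply: eq_card => y; rewrite !inE /toggle xab xS andbF orbF /=.
      by case yS: (y \in S); rewrite ?andbF // ?andbT (subsetP SU) //= addbT.
    rewrite -side //; apply: eq_card => y; rewrite !inE.
    by case yS: (y \in S); rewrite ?andbF // ?andbT (subsetP SU).
  apply: eq_card => y; rewrite !inE /toggle xab xS andbF orbF /=.
  by case yS: (y \in S); rewrite //= addbF.
have [xS | xS] := boolP (x \in S); last first.
  by apply: eq_card => y; rewrite !inE /toggle (negbTE xab) (negbTE xS) andbF addbF.
have N c d (G' : rel V) : c \in U -> d \in U -> c != d -> G' x c -> ~~ G' x d ->
    #|nb U G' x| = #|nb U G' x :\: [set c; d]|.+1.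
  move=> cU dU cd Gc Gd; rewrite -(cardsID [set c; d] (nb U G' x)) -add1n; congr (_ + _).
  rewrite -(cards1 c); apply: eq_card => y; rewrite !inE.
  have [->|yc] := eqVneq y c; first by rewrite cU Gc.
  by have [->|yd] := eqVneq y d; rewrite ?andbF //= (negbTE Gd) ?andbF.
have E : nb U (toggle a b S G) x :\: [set a; b] = nb U G x :\: [set a; b].
  apply/setP=> y; rewrite !inE /toggle.
  case: (boolP ((y == a) || (y == b))) => //= yab.
  by rewrite !inE (negbTE yab) /= orbF -in_set2 (negbTE xab) addbF.
have Ta : toggle a b S G x a = ~~ G x a.
  by rewrite /toggle (negbTE xab) !inE eqxx xS /= addbT.
have Tb : toggle a b S G x b = ~~ G x b.
  by rewrite /toggle (negbTE xab) !inE eqxx xS orbT /= addbT.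
have ax := alt _ xS; rewrite sG [G b x]sG in ax.
have E2 : [set b; a] = [set a; b] by apply/setP=> y; rewrite !inE orbC.
case Gb: (G x b) ax => /= Ga.
  rewrite (N a b (toggle a b S G)) ?Ta ?Tb ?Ga ?Gb // E.
  by rewrite (N b a G) ?Ga ?Gb 1?eq_sym // E2.
rewrite (N b a (toggle a b S G)) ?Ta ?Tb ?Ga ?Gb 1?eq_sym // E2 E.
by rewrite (N a b G) ?Ga ?Gb.
Qed.

(** Otherwise the neighbours of [y] other than [x] would lie among those of [x] other than [y] and
    [r]. A possible edge [xy] counts equally on both sides, so [y] would have the smaller degree. *)
Lemma exchange_neighbour (V : finType) (U : {set V}) (G : rel V) (x y r : V) :
  simple_graph G -> x \in U -> y \in U -> #|nb U G x| <= #|nb U G y| ->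
  r \in U -> G x r -> ~~ G y r -> r != y ->
  exists z, [/\ z \in U, G y z, ~~ G x z & z != x].
Proof.
move=> [sG iG] xU yU le rU xr yr ry.
case: (pickP [pred z | [&& z \in U, G y z, ~~ G x z & z != x]]) => [z /and4P[]|no].
  by exists z.
have sub : nb U G y :\ x \subset (nb U G x :\ y) :\ r.
  apply/subsetP=> z; rewrite !inE => /and3P[zx zU yz].
  have := no z; rewrite /= zU yz zx /= andbT => /negbFE xz.
  rewrite xz andbT /=; apply/andP; split.
    by apply: contraNneq yr => <-.
  by rewrite ?zU ?andbT; apply: contraTneq yz => ->; rewrite iG.
have := subset_leq_card sub.
have := cardsD1 r (nb U G x :\ y); rewrite !inE ry rU xr /=.
have := cardsD1 x (nb U G y); have := cardsD1 y (nb U G x).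
rewrite !inE xU yU [G y x]sG /=; move: le; lia.
Qed.

(** The classical two-switch: edges [ac], [bd] become [ad], [bc]. *)
Lemma switch_equideg (V : finType) (U : {set V}) (a b c d : V) (G : rel V) :
  simple_graph G -> [/\ a \in U, b \in U, c \in U & d \in U] ->
  a != b -> a != d -> b != c -> [/\ G a c, ~~ G a d, ~~ G b c & G b d] ->
  equideg U G (toggle a b [set c; d] G).
Proof.
move=> [sG iG] [aU bU cU dU] ab ad bc [ac nad nbc bd].
have ca : a != c by apply: contraTneq ac => ->; rewrite iG.
have db : b != d by apply: contraTneq bd => ->; rewrite iG.
have cd : c != d by apply: contraTneq ac => ->.
apply: toggle_equideg => //.
- by apply/subsetP=> x; rewrite !inE => /orP[] /eqP ->.
- by rewrite !inE negb_or ca ad.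
- by rewrite !inE negb_or bc db.
- by move=> x; rewrite !inE => /orP[] /eqP ->; rewrite ?ac ?bd ?(negbTE nbc) ?(negbTE nad).
transitivity 1.
  rewrite -(cards1 c); apply: eq_card => x; rewrite !inE.
  by have [->|/=] := eqVneq x c => //; have [->|] := eqVneq x d; rewrite //= (negbTE nad).
rewrite -(cards1 d); apply: eq_card => x; rewrite !inE.
have [->|/=] := eqVneq x c; first by rewrite /= (negbTE nbc) (negbTE cd).
by have [->|] := eqVneq x d; rewrite //= bd.
Qed.

(** Havel-Hakimi exchange. If a neighbour [x] of [o] has smaller degree than a non-neighbour [y], a
    two-switch puts [y] in place of [x]. This raises the degree sum [w] of the neighbourhood, which
    is bounded, so the process stops. *)
Lemma lay_off (V : finType) (U : {set V}) (G : rel V) (o : V) :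
  simple_graph G -> o \in U ->
  exists G', equideg U G G' /\
    forall x y, x \in nb U G' o -> y \in U -> y \notin nb U G' o -> y != o ->
      #|nb U G y| <= #|nb U G x|.
Proof.
move=> sG oU; pose d x := #|nb U G x|; pose w (K : rel V) := \sum_(x in nb U K o) d x.
have wB K : w K <= \sum_(x in U) d x.
  rewrite [leqRHS](big_setID (nb U K o)) /= (setIidPr _) ?leq_addr //.
  by apply/subsetP=> x; rewrite inE => /andP[].
have step (K : rel V) x y : equideg U G K -> x \in nb U K o -> y \in U ->
    y \notin nb U K o -> y != o -> d x < d y -> exists2 K', equideg U G K' & w K < w K'.
  move=> eK xN yU yN yo lt; have [[sK iK] _ dK] := eK.
  have := xN; rewrite !inE => /andP[xU ox]; have := yN; rewrite !inE yU /= => oy.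
  have [||||||||z [zU yz xz zx]] := @exchange_neighbour V U K x y o;
    rewrite ?dK // ?[K _ o]sK 1?eq_sym //; first exact: ltnW.
  have zo : o != z by apply: contraTneq yz => <-; rewrite sK.
  exists (toggle o z [set x; y] K).
    apply: (equideg_trans eK); apply: switch_equideg => //; first by rewrite eq_sym.
    by split=> //; rewrite sK.
  have xo : x != o by apply: contraTneq ox => ->; rewrite iK.
  have xy : y == x = false by apply: contraTF lt => /eqP ->; rewrite ltnn.
  have -> : w (toggle o z [set x; y] K) = \sum_(v in y |: (nb U K o :\ x)) d v.
    apply: eq_bigl => v; rewrite !inE /toggle !inE eqxx (negbTE zo) /=.
    rewrite (eq_sym o x) (negbTE xo) (eq_sym o y) (negbTE yo) /= andbF orbF.
    have [->|vx] := eqVneq v x; first by rewrite ox /= andbF eq_sym xy.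
    by have [->|vy] := eqVneq v y; [rewrite yU (negbTE oy)|rewrite /= addbF].
  rewrite big_setU1 ?inE ?yU ?(negbTE oy) ?andbF //= /w (big_setD1 x xN) /=.
  by rewrite ltn_add2r.
suff H n (K : rel V) : equideg U G K -> \sum_(x in U) d x - w K <= n ->
    exists G', equideg U G G' /\
    forall x y, x \in nb U G' o -> y \in U -> y \notin nb U G' o -> y != o -> d y <= d x.
  exact: (H _ _ (equideg_refl U sG) (leqnn _)).
elim: n K => [|n IH] K eK le;
  case: (pickP [pred p : V * V | [&& p.1 \in nb U K o, p.2 \in U, p.2 \notin nb U K o,
    p.2 != o & d p.1 < d p.2]]) => [[x y] /= /and5P[xN yU yN yo lt]|no];
  try (by exists K; split=> // x y xN yU yN yo; have := no (x, y);
    rewrite /= xN yU yN yo /= => /negbT; rewrite -leqNgt);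
  have [K' eK' ltw] := step _ _ _ eK xN yU yN yo lt; have wK' := wB K'.
  by move: le; rewrite leqn0 subn_eq0 leqNgt (leq_trans ltw wK').
by apply: (IH K') => //; move: ltw wK' le; clear; lia.
Qed.

Lemma top_subset (V : finType) (A : {set V}) (f : V -> nat) (k : nat) :
  k <= #|A| -> exists B : {set V}, [/\ B \subset A, #|B| = k &
    forall x y, x \in B -> y \in A -> y \notin B -> f y <= f x].
Proof.
elim: k => [_|k IH lt].
  by exists set0; rewrite sub0set cards0; split=> // x y; rewrite inE.
have [B [BA cB top]] := IH (ltnW lt).
have /card_gt0P[z0 z0P] : 0 < #|A :\: B| by rewrite cardsDS // cB subn_gt0.
case: (@arg_maxnP _ z0 [pred z | z \in A :\: B] f z0P) => z /= zAB zmax.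
have := zAB; rewrite inE => /andP[zB zA].
exists (z |: B); rewrite subUset sub1set zA BA cardsU1 zB cB; split=> // x y.
rewrite !inE negb_or => /orP[/eqP -> | xB] yA /andP[yz yB]; last exact: top.
by apply: zmax; rewrite !inE yB.
Qed.

Lemma subset_between (V : finType) (A B : {set V}) (k : nat) :
  A \subset B -> #|A| <= k <= #|B| ->
  exists C : {set V}, [/\ A \subset C, C \subset B & #|C| = k].
Proof.
move=> AB /andP[Ak kB].
have [|C [CB cC _]] := @top_subset _ (B :\: A) (fun=> 0) (k - #|A|).
  by rewrite cardsDS // leq_sub2r.
exists (A :|: C); rewrite subsetUl subUset AB; split=> //.
  by apply: subset_trans CB _; apply: subsetDl.
rewrite cardsU (_ : A :&: C = set0) ?cards0 ?subn0 ?cC ?subnKC //.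
by apply/setP=> x; rewrite !inE; case: (boolP (x \in C)) => [/(subsetP CB)|]; rewrite ?inE ?andbF // => /andP[/negbTE ->].
Qed.

(** The clique members [Ms] missed by [c] are private neighbours of [z]. As [c] has at least the
    degree of [z], it has as many private neighbours [Y], and these avoid the clique. Toggling [z]
    and [c] over both sets joins [c] to the rest of the clique. *)
Lemma shift_clique (V : finType) (U C : {set V}) (G : rel V) (z c : V) :
  simple_graph G -> C \subset U -> (forall x y, x \in C -> y \in C -> x != y -> G x y) ->
  z \in C -> c \in U -> c \notin C -> #|nb U G z| <= #|nb U G c| ->
  exists G', equideg U G G' /\
    forall x y, x \in c |: (C :\ z) -> y \in c |: (C :\ z) -> x != y -> G' x y.
Proof.
move=> [sG iG] CU cl zC cU cC le; have zU := subsetP CU _ zC.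
have zc : z != c by apply: contraTneq zC => ->.
pose Ms := [set r in C :\ z | ~~ G c r].
pose A0 := (nb U G z :\: nb U G c) :\ c; pose B0 := (nb U G c :\: nb U G z) :\ z.
have MA : Ms \subset A0.
  apply/subsetP=> r; rewrite !inE => /andP[/andP[rz rC] cr].
  have zr : G z r by apply: cl; rewrite // eq_sym.
  rewrite (subsetP CU) // zr (negbTE cr) /= andbT.
  by apply: contraNneq cC => <-.
(* A possible edge [zc] puts [c] on one side and [z] on the other; removing both keeps the
   comparison of degrees. *)
have AB : #|A0| <= #|B0|.
  have := cardsID (nb U G c) (nb U G z); have := cardsID (nb U G z) (nb U G c).
  rewrite setIC (cardsD1 c (nb U G z :\: _)) (cardsD1 z (nb U G c :\: _)).
  rewrite -/A0 -/B0 !inE zU cU !iG /= [G c z]sG; move: le; lia.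
have [Y [_ YB cY]] : exists Y : {set V}, [/\ set0 \subset Y, Y \subset B0 & #|Y| = #|Ms|].
  by apply: subset_between; rewrite ?sub0set // cards0 (leq_trans (subset_leq_card MA)).
have BP y : y \in B0 -> [/\ y \in U, G c y, ~~ G z y, y != z & y \notin C].
  rewrite !inE => /and3P[yz nzy /andP[yU cy]]; rewrite yU /= in nzy; split=> //.
  by apply: contra nzy => yC; apply: cl => //; rewrite eq_sym.
have MP r : r \in Ms -> [/\ r \in C, r \in U, G z r, ~~ G c r & r != z].
  rewrite !inE => /andP[/andP[rz rC] ->]; rewrite rC (subsetP CU) //; split=> //.
  by apply: cl; rewrite // eq_sym.
exists (toggle z c (Ms :|: Y) G); split.
  apply: toggle_equideg => //.
  - apply/subsetP=> x; rewrite inE => /orP[/MP[]//|/(subsetP YB)/BP[]//].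
  - by apply/negP; rewrite inE => /orP[/MP[]|/(subsetP YB)/BP[]]; rewrite eqxx.
  - apply/negP; rewrite inE => /orP[/MP[cC']|/(subsetP YB)/BP[]]; last by rewrite iG.
    by rewrite cC' in cC.
  - by move=> x; rewrite inE => /orP[/MP[_ _ -> /negbTE ->]|/(subsetP YB)/BP[_ -> /negbTE ->]].
  transitivity #|Ms|.
    apply: eq_card => x; rewrite [LHS]inE [_ \in _ :|: _]inE.
    case xM: (x \in Ms); first by case/MP: xM => _ _ ->.
    by case xY: (x \in Y) => //; move/(subsetP YB)/BP: xY => [_ _ /negbTE ->].
  rewrite -cY; apply: eq_card => x; rewrite [RHS]inE [_ \in _ :|: _]inE.
  case xM: (x \in Ms).
    have [xC _ _ /negbTE -> _] := MP _ xM; rewrite andbF.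
    by apply/negP => /(subsetP YB)/BP[_ _ _ _]; rewrite xC.
  by case xY: (x \in Y) => //; move/(subsetP YB)/BP: xY => [_ ->].
have T r : r \in C -> r != z -> toggle z c (Ms :|: Y) G c r.
  move=> rC rz; rewrite /toggle !inE eqxx orbT rz rC /= (negbTE rz).
  have -> : r == c = false by apply: contraNF cC => /eqP <-.
  have -> : r \in Y = false by apply/negP => /(subsetP YB)/BP[_ _ _ _]; rewrite rC.
  by rewrite orbF /= orbF; case: (G c r).
have [sT _] : simple_graph (toggle z c (Ms :|: Y) G).
  split=> [x y | x]; last first.
    rewrite /toggle iG addFb orbb; apply/negbTE/negP => /andP[].
    rewrite in_set2 => /orP[] /eqP ->; rewrite inE => /orP[/MP[]|/(subsetP YB)/BP[]]; rewrite ?eqxx ?iG //.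
    by rewrite (negbTE cC).
  by rewrite /toggle sG; congr (_ (+) _); rewrite orbC.
move=> x y; rewrite !inE => /orP[/eqP -> | /andP[xz xC]] /orP[/eqP -> | /andP[yz yC]] xy.
- by rewrite eqxx in xy.
- exact: T.
- by rewrite sT; apply: T.
rewrite /toggle !in_set2 (negbTE xz) (negbTE yz) /=.
have -> : x == c = false by apply: contraNF cC => /eqP <-.
have -> : y == c = false by apply: contraNF cC => /eqP <-.
by rewrite addbF cl.
Qed.

(** * Near-regular sequences are graphic *)

Lemma sum_setD1 (V : finType) (U : {set V}) (x : V) (f : V -> nat) :
  x \in U -> \sum_(y in U) f y = f x + \sum_(y in U :\ x) f y.
Proof. exact: big_setD1. Qed.

Lemma nb_setD1 (V : finType) (U : {set V}) (G : rel V) (x y : V) :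
  x \in U -> #|nb U G y| = G y x + #|nb (U :\ x) G y|.
Proof.
move=> xU; rewrite (cardsD1 x) inE xU /=; congr (_ + _).
by apply: eq_card => z; rewrite !inE andbA.
Qed.

Lemma sum_mem (V : finType) (A B : {set V}) : A \subset B ->
  \sum_(y in B) (y \in A : nat) = #|A|.
Proof.
move=> AB; rewrite -sum1_card [RHS]big_mkcond [LHS]big_mkcond /=.
apply: eq_bigr => y _; case: (boolP (y \in A)) => [/(subsetP AB) ->|] //.
by case: ifP.
Qed.

(** Removing a vertex lowers the degree sum by twice its degree. *)
Lemma handshake_even (V : finType) (U : {set V}) (G : rel V) :
  simple_graph G -> ~~ odd (\sum_(x in U) #|nb U G x|).
Proof.
move=> [sG iG]; move: {2}#|U| (erefl #|U|) => n.
elim: n U => [|n IH] U cU.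
  by rewrite (cards0_eq cU) big_set0.
have /card_gt0P[x xU] : 0 < #|U| by rewrite cU.
rewrite (sum_setD1 _ xU).
under eq_bigr => y _ do rewrite (nb_setD1 _ _ xU).
rewrite big_split /= (nb_setD1 _ _ xU) iG add0n.
have -> : \sum_(y in U :\ x) G y x = #|nb (U :\ x) G x|.
  have sub : nb (U :\ x) G x \subset U :\ x by apply/subsetP=> y; rewrite inE => /andP[].
  rewrite -(sum_mem sub).
  by apply: eq_bigr => y yU; rewrite inE yU sG.
rewrite addnA addnn oddD odd_double /=; apply: IH.
by move: cU; rewrite (cardsD1 x) xU => -[].
Qed.

Definition graphic_on (V : finType) (U : {set V}) (d : V -> nat) : Prop :=
  exists2 G, simple_graph G & forall x, x \in U -> #|nb U G x| = d x.

(** The constructive half of Havel-Hakimi: [x] is joined to [A] in a realization of the reduced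
    demands. Positivity on [A] keeps the truncated subtraction exact. *)
Lemma graphic_on_add (V : finType) (U A : {set V}) (x : V) (d : V -> nat) :
  x \in U -> A \subset U :\ x -> #|A| = d x -> (forall y, y \in A -> 0 < d y) ->
  graphic_on (U :\ x) (fun y => d y - (y \in A)) -> graphic_on U d.
Proof.
move=> xU AU cA pos [G [sG iG] dG].
pose G' u v := if u == x then v \in A else if v == x then u \in A else G u v.
have xA : x \notin A by apply: contraTN isT => /(subsetP AU); rewrite !inE eqxx.
exists G'; first split.
- by move=> u v; rewrite /G'; case: eqVneq => [->|_]; case: eqVneq => // ->.
- by move=> u; rewrite /G'; case: eqVneq => [->|_]; [exact/negbTE | exact: iG].
move=> y yU; rewrite (nb_setD1 _ _ xU); have [-> {y yU}|yx] := eqVneq y x.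
  rewrite /G' eqxx (negbTE xA) add0n -cA; apply: eq_card => v; rewrite !inE.
  rewrite eqxx; case vA: (v \in A); last by rewrite andbF.
  by have := subsetP AU _ vA; rewrite !inE => ->.
have -> : #|nb (U :\ x) G' y| = #|nb (U :\ x) G y|.
  by apply: eq_card => v; rewrite !inE /G' (negbTE yx); case: eqVneq.
rewrite dG ?inE ?yx // /G' (negbTE yx) eqxx.
by case: (boolP (y \in A)) => [/pos|]; lia.
Qed.

(* Remove a vertex of maximum degree [p] and join it to the [p] largest remaining ones:
   either a vertex of degree [p] survives, and then [p + 2] of them were present, or the
   maximum drops to [p - 1]. *)
Lemma graphic_near_regular (V : finType) (U : {set V}) (d : V -> nat) (p : nat) :
  (forall x, x \in U -> d x <= p) -> p < #|[set x in U | p <= (d x).+1]| ->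
  ~~ odd (\sum_(x in U) d x) -> graphic_on U d.
Proof.
move: {2}(#|U| + p) (leqnn (#|U| + p)) => n; elim: n U d p => [|n IH] U d p le dp cp ev.
  have U0 : U = set0 by apply: cards0_eq; move: le; lia.
  by exists (fun _ _ => false) => // x; rewrite U0 inE.
case: (posnP p) => [p0|p_gt0].
  exists (fun _ _ => false) => // x xU; have := dp _ xU; rewrite p0 leqn0 => /eqP ->.
  by apply: eq_card0 => y; rewrite !inE andbF.
case: (pickP [pred x | (x \in U) && (d x == p)]) => [x /= /andP[xU /eqP dx]|no]; last first.
  (* With no demand equal to [p], the bound drops to [p.-1], and the vertices counted before still
     count. *)
  have dp' x : x \in U -> d x <= p.-1.
    by move=> xU; have := dp _ xU; have := no x; rewrite /= xU /=; lia.
  apply: (IH U d p.-1) => //; first by move: le; lia.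
  apply: leq_trans (subset_leq_card (_ : [set x in U | p <= (d x).+1] \subset _)).
    by move: cp; lia.
  by apply/subsetP=> x; rewrite !inE => /andP[->] /=; lia.
pose W := U :\ x; pose Gp := [set y in W | p <= (d y).+1].
have cGp : p <= #|Gp|.
  move: cp; rewrite (cardsD1 x) inE xU dx leqnSn /=.
  suff -> : [set x0 in U | p <= (d x0).+1] :\ x = Gp by lia.
  by apply/setP=> y; rewrite !inE andbA.
have GW : Gp \subset W by apply/subsetP=> y; rewrite inE => /andP[].
have [|A [AW cA top]] := @top_subset _ W d p; first exact: leq_trans cGp (subset_leq_card GW).
have AG : A \subset Gp.
  apply/subsetP=> y yA; rewrite inE (subsetP AW) //=; rewrite leqNgt; apply/negP => lt.
  have : Gp \subset A :\ y.
    apply/subsetP=> z zG; have := zG; rewrite !inE => /andP[/andP[zx zU] pz].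
    apply/andP; split; first by apply: contraTneq pz => ->; rewrite -ltnNge.
    apply/negPn/negP => zA; have := top _ _ yA (subsetP GW _ zG) zA; lia.
  by move/subset_leq_card; move: cA; rewrite (cardsD1 y) yA; lia.
have sumU : \sum_(y in U) d y = d x + \sum_(y in W) d y := sum_setD1 _ xU.
(* A zero demand in [A] forces [p = 1] and leaves [x] as the only vertex of positive demand, so the
   sum would be odd. *)
have pos y : y \in A -> 0 < d y.
  move=> yA; rewrite lt0n; apply/negP => /eqP d0.
  have p1 : p = 1 by have := subsetP AG _ yA; rewrite inE d0 => /andP[_]; lia.
  have A1 : A = [set y].
    by apply/eqP; rewrite eq_sym eqEcard sub1set yA cA cards1 p1.
  move: ev; rewrite sumU big1 ?dx ?p1 // => z zW.
  have [->//|zy] := eqVneq z y; apply/eqP; rewrite -leqn0 -d0; apply: top => //.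
  by rewrite A1 inE.
have sumW : \sum_(y in W) d y = \sum_(y in W) (d y - (y \in A)) + p.
  rewrite -cA -(sum_mem AW) -big_split /=; apply: eq_bigr => y _.
  by case: (boolP (y \in A)) => [/pos|]; lia.
have ev' : ~~ odd (\sum_(y in W) (d y - (y \in A))).
  by move: ev; rewrite sumU sumW dx; lia.
apply: (graphic_on_add xU AW) => //; first by rewrite cA.
have cW : #|U| = #|W|.+1 by rewrite (cardsD1 x) xU.
case: (pickP [pred y | (y \in W) && (y \notin A) && (d y == p)]) => [z /andP[/andP[/= zW zA] /eqP dz]|no].
  apply: (IH W _ p) => //; first by move: le; lia.
    by move=> y; rewrite inE => /andP[_ /dp]; lia.
  apply: leq_trans (subset_leq_card (_ : z |: A \subset _)).
    by rewrite cardsU1 zA cA.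
  apply/subsetP=> y; rewrite !inE => /orP[/eqP ->|yA].
    by have := zW; rewrite !inE => ->; rewrite dz (negbTE zA); lia.
  have := subsetP AW _ yA; rewrite yA !inE => -> /=.
  by have := top _ _ yA zW zA; rewrite dz; lia.
apply: (IH W _ p.-1) => //; first by move: le; lia.
  move=> y yW; have := no y; rewrite /= yW /=.
  have := yW; rewrite inE => /andP[_ /dp]; case: (y \in A) => /=; lia.
apply: leq_trans (subset_leq_card (_ : Gp \subset _)); first by move: cGp; lia.
by apply/subsetP=> y; rewrite !inE => /andP[->] /=; case: (y \in A); lia.
Qed.

(** * A direct construction of a clique *)

(* Each [m] in [M] is joined to the [g m] members of [L] of largest residual demand; since
   [g m < #|E|], some member of [E] is spared and keeps the demands within one of each other. *)
Lemma balanced_layoff (V : finType) (L E M : {set V}) (r g : V -> nat) :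
  E \subset L -> (forall m, m \in M -> g m < #|E|) ->
  (forall l, l \in E -> #|M| <= r l) ->
  (forall l l', l \in E -> l' \in L -> r l' <= (r l).+1) ->
  exists A : V -> {set V},
  [/\ forall m, m \in M -> A m \subset L /\ #|A m| = g m,
      forall l, l \in L -> #|[set m in M | l \in A m]| <= r l
    & forall l l', l \in L -> l' \in L ->
        (l \in E) || (0 < #|[set m in M | l \in A m]|) ->
        r l' - #|[set m in M | l' \in A m]| <= (r l - #|[set m in M | l \in A m]|).+1].
Proof.
move=> EL; move: {2}#|M| (erefl #|M|) => n; elim: n M => [|n IH] M cM gM rM rE.
  have c0 (A : V -> {set V}) l : #|[set m in M | l \in A m]| = 0.
    by apply: eq_card0 => m; rewrite !inE (cards0_eq cM) inE.
  exists (fun=> set0); split=> [m|l lL|l l' lL l'L].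
  - by rewrite (cards0_eq cM) inE.
  - by rewrite c0.
  - by rewrite !c0 !subn0 orbF => lE; apply: rE.
have /card_gt0P[m0 m0M] : 0 < #|M| by rewrite cM.
have cM' : #|M :\ m0| = n by move: cM; rewrite (cardsD1 m0) m0M => -[].
have [m /setD1P[_ /gM] //|l /rM|//|A' [A'L cr bal]] := IH _ cM'.
  by rewrite cM cM' => /ltnW.
pose c' l := #|[set m in M :\ m0 | l \in A' m]|; pose q l := r l - c' l.
rewrite -/(c' _) in cr bal.
have [|A [AL cA top]] := @top_subset _ L q (g m0).
  by apply: leq_trans (ltnW (gM _ m0M)) (subset_leq_card EL).
have [b bE bA] : exists2 b, b \in E & b \notin A.
  case: (pickP [pred b in E | b \notin A]) => [b /andP[]|no]; first by exists b.
  have : #|E| <= #|A|.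
    by apply: subset_leq_card; apply/subsetP=> b bE; have := no b; rewrite inE /= bE => /negbFE.
  by rewrite cA leqNgt gM.
have bL := subsetP EL _ bE.
(* The earlier sets number [#|M| - 1], so [b], of initial demand at least [#|M|], is not exhausted;
   members of [A] have at least the residual demand of [b]. *)
have qb : 0 < q b.
  rewrite subn_gt0; apply: leq_trans (rM _ bE).
  rewrite cM ltnS -cM'; apply: subset_leq_card; apply/subsetP=> m.
  by rewrite inE => /andP[].
exists (fun m => if m == m0 then A else A' m).
have cE l : #|[set m in M | l \in (if m == m0 then A else A' m)]| = (l \in A) + c' l.
  rewrite (cardsD1 m0) inE m0M eqxx /=; congr (_ + _).
  by apply: eq_card => m; rewrite !inE; case: eqVneq.
have posA l : l \in A -> 0 < q l.
  by move=> lA; apply: leq_trans qb (top _ _ lA bL bA).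
split=> [m mM|l lL|l l' lL l'L].
- have [->|mm0] := eqVneq m m0; first by rewrite cA.
  by apply: A'L; rewrite !inE mm0.
- rewrite cE; case: (boolP (l \in A)) => [/posA|_] /=; last exact: cr.
  by rewrite subn_gt0.
rewrite !cE => lEc.
have -> : r l - ((l \in A) + c' l) = q l - (l \in A) by rewrite addnC subnDA.
have -> : r l' - ((l' \in A) + c' l') = q l' - (l' \in A) by rewrite addnC subnDA.
have balb : q l' <= (q b).+1 by apply: bal; rewrite ?bE.
(* A vertex [l] chosen only now need not have been balanced before; its comparison with [b] takes
   over that role. *)
case: (boolP (l \in A)) => lA; rewrite ?(negbTE lA) ?lA /= in lEc *.
  have := posA _ lA; have := top _ _ lA bL bA.
  case: (boolP (l' \in A)) => [/posA|l'A] /=; first by move: balb; clear; lia.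
  by have := top _ _ lA l'L l'A; clear; lia.
rewrite subn0; apply: leq_trans (leq_subr _ _) _; exact: bal.
Qed.

Lemma equideg_of_graphic (V : finType) (U : {set V}) (G H : rel V) :
  simple_graph G -> simple_graph H -> (forall x, x \in U -> #|nb U H x| = #|nb U G x|) ->
  equideg U G (fun x y => if (x \in U) && (y \in U) then H x y else G x y).
Proof.
move=> [sG iG] [sH iH] dH; split.
- split=> [x y|x]; first by rewrite andbC sG sH.
  by rewrite iG iH if_same.
- by move=> x y /negbTE ->.
- move=> x xU; rewrite -dH //; apply: eq_card => y; rewrite !inE xU.
  by case: (y \in U).
Qed.

(** The parabola [k * (e.+1 - k)] is symmetric about half of [e.+1]. For [s < C], the inequality
    [e.+1 < C + s] puts [C] farther from the centre than [s], so its value at [C] is not larger; for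
    [C <= s] both factors compare directly. *)
Lemma clique_arith (s e p C D R : nat) :
  0 < s -> s <= e.+1 -> s <= p -> D + 2 <= C + s -> e <= D -> C <= p -> p <= e ->
  s * (e.+1 - s) <= R -> R < C * (e.+1 - p) -> False.
Proof.
move=> s0 se sp DC eD Cp pe R1 R2.
have H : s * (e.+1 - s) < C * (e.+1 - p) by apply: leq_ltn_trans R2.
move: H; rewrite ltnNge => /negP; apply; have [Cs|sC] := leqP C s.
  by apply: leq_mul => //; lia.
apply: (@leq_trans (C * (e.+1 - C))); first by rewrite leq_mul2l; apply/orP; right; lia.
have [x eE] : exists x, e.+1 = C + x by exists (e.+1 - C); lia.
have [y CE] : exists y, C = s + y by exists (C - s); lia.
rewrite eE CE; have -> : s + y + x - (s + y) = x by lia.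
have -> : s + y + x - s = y + x by lia.
have xs : x <= s by lia.
by rewrite mulnDl mulnDr addnC leq_add2r mulnC leq_mul2r xs orbT.
Qed.

(** The set [M], which contains all vertices of degree above [e], becomes the clique. Its excess [g]
    is laid off on [L] by [balanced_layoff], and [graphic_near_regular] realizes the residual
    demands [r]. *)
Lemma potential_clique (V : finType) (U : {set V}) (G : rel V) (s e D : nat) :
  simple_graph G -> 0 < s -> s <= e.+1 -> s <= D.+1 -> e <= D ->
  (forall x, x \in U -> #|nb U G x| <= D) ->
  #|[set x in U | e < #|nb U G x|]| < s ->
  D + 2 <= #|[set x in U | e <= #|nb U G x|]| ->
  2 * s <= #|[set x in U | s <= #|nb U G x| + 2]| ->
  exists G' (C : {set V}), [/\ equideg U G G', C \subset U, #|C| = s &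
    forall x y, x \in C -> y \in C -> x != y -> G' x y].
Proof.
pose d x := #|nb U G x|.
move=> sG s0 se sD eD dD.
move=> cF cEall c2s.
change (is_true (#|[set x in U | e < d x]| < s)) in cF.
change (is_true (D + 2 <= #|[set x in U | e <= d x]|)) in cEall.
change (is_true (2 * s <= #|[set x in U | s <= d x + 2]|)) in c2s.
have [|| M [FM ME cM]] := @subset_between _ [set x in U | e < d x] [set x in U | e <= d x] s.
- by apply/subsetP=> x; rewrite !inE => /andP[-> /ltnW].
- rewrite (ltnW cF) /=; apply: leq_trans cEall; move: sD; clear; lia.
have MU : M \subset U by apply: subset_trans ME _; apply/subsetP=> x; rewrite inE => /andP[].
have Md x : x \in M -> e <= d x by move=> /(subsetP ME); rewrite inE => /andP[].
pose L := U :\: M; pose E := [set x in U | e <= d x] :\: M.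
have EL : E \subset L by apply: setSD; apply/subsetP=> x; rewrite inE => /andP[].
have Ld x : x \in L -> d x <= e.
  rewrite inE => /andP[xM xU]; rewrite leqNgt; apply: contra xM => lt.
  by apply: (subsetP FM); rewrite inE xU.
have Ed x : x \in E -> d x = e.
  by move=> xE; apply/eqP; rewrite eqn_leq (Ld _ (subsetP EL _ xE)); move: xE; rewrite !inE => /and3P[].
have cE : D + 2 <= #|E| + s by rewrite cardsDS // cM; move: cEall; lia.
(* Members of degree below [s] have no excess. Leaving them out gives [#|Mp| <= e] even when
   [e = s.-1], since [Mp] then consists of vertices of degree above [e]. *)
pose Mp := [set m in M | s <= d m]; pose g m := d m - s.-1.
have [|||A [AL cd bal]] := @balanced_layoff _ L E Mp d g EL.
- move=> m; rewrite inE => /andP[mM _]; have : d m <= D := dD _ (subsetP MU _ mM).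
  by rewrite /g; move: cE sD s0; clear; lia.
- move=> l /Ed ->; have [es|es] := leqP s e.
    by apply: leq_trans es; rewrite -cM; apply: subset_leq_card; apply/subsetP=> m; rewrite inE => /andP[].
  have es' : e = s.-1 by move: se es; clear; lia.
  rewrite -ltnS es' prednK //; apply: leq_ltn_trans cF; apply: subset_leq_card.
  apply/subsetP=> m; rewrite !inE => /andP[mM sm]; rewrite (subsetP MU) //=.
  by rewrite es' prednK.
- by move=> l l' /Ed -> /Ld /leqW.
pose A' m := if m \in Mp then A m else set0.
pose c l := #|[set m in M | l \in A' m]|.
have cE' l : #|[set m in Mp | l \in A m]| = c l.
  apply: eq_card => m; rewrite [LHS]inE [RHS]inE /A' [in LHS]inE.
  case: (boolP (m \in Mp)); rewrite ?inE; first by move=> /andP[-> ->].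
  by case: (m \in M) => //= /negbTE ->.
have cd' l : l \in L -> c l <= d l by move=> /cd; rewrite cE'.
have bal' l l' : l \in L -> l' \in L -> (l \in E) || (0 < c l) -> d l' - c l' <= (d l - c l).+1.
  by move=> lL l'L; have := bal _ _ lL l'L; rewrite !cE'.
have A'L m : m \in M -> A' m \subset L /\ #|A' m| = g m.
  move=> mM; rewrite /A'; case: (boolP (m \in Mp)) => [/AL //|].
  rewrite inE mM /= -ltnNge => lt; rewrite sub0set cards0; split=> //.
  by rewrite /g; move: lt s0; clear; lia.
pose r l := d l - c l; pose R := \sum_(m in M) g m.
have RE : R = \sum_(l in L) c l.
  rewrite /R (eq_bigr (fun m => \sum_(l in L) (l \in A' m))); last first.
    by move=> m /A'L[sub <-]; rewrite sum_mem.
  rewrite exchange_big /=; apply: eq_bigr => l lL.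
  rewrite -[RHS](@sum_mem _ _ M); last by apply/subsetP=> m; rewrite inE => /andP[].
  by apply: eq_bigr => m mM; rewrite inE mM.
have sumM : \sum_(m in M) d m = R + s * s.-1.
  rewrite -{1}cM -sum_nat_const /R -big_split /=; apply: eq_bigr => m /Md.
  by rewrite /g; move: se s0; clear; lia.
have sumL : \sum_(l in L) d l = \sum_(l in L) r l + R.
  by rewrite RE -big_split /=; apply: eq_bigr => l /cd'; rewrite /r; lia.
have evL : ~~ odd (\sum_(l in L) r l).
  have := handshake_even U sG; rewrite (big_setID M) /= (setIidPr MU) sumM sumL.
  have -> : R + s * s.-1 + (\sum_(l in L) r l + R) = \sum_(l in L) r l + (s * s.-1 + R.*2).
    by rewrite -addnn; clear; lia.
  by rewrite !oddD odd_double oddM addbF; case: (s) => [|k] /=; rewrite ?andNb ?addbF.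
have R1 : s * (e.+1 - s) <= R.
  rewrite -{1}cM -sum_nat_const; apply: leq_sum => m /Md.
  by rewrite /g; move: se s0; clear; lia.
have E0 : 0 < #|E| by move: cE sD; clear; lia.
have /card_gt0P[l1 l1E] := E0; have l1L := subsetP EL _ l1E.
have [l0 l0L l0max] : exists2 l0, l0 \in L & forall l, l \in L -> r l <= r l0.
  case: (@arg_maxnP _ l1 [pred l | l \in L] r l1L) => l0 /= l0L l0max.
  by exists l0.
pose p := r l0; pose Gp := [set l in L | p <= (r l).+1].
have inG l : l \in L -> (l \in E) || (0 < c l) -> l \in Gp.
  by move=> lL lc; rewrite inE lL; apply: bal'.
have cGp : p < #|Gp|.
  rewrite ltnNge; apply/negP => Cp.
  have pe : p <= e by apply: leq_trans (leq_subr _ _) (Ld _ l0L).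
  have CE : #|E| <= #|Gp|.
    by apply: subset_leq_card; apply/subsetP=> l lE; rewrite inG ?lE ?(subsetP EL).
  (* If [p < s], an untouched vertex of [L] of degree at least [s - 2] lies in [Gp]. All vertices of
     such degree are then in [M] or [Gp], fewer than [2 * s] in total. *)
  have [sp|ps] := leqP s p; last first.
    have : #|[set x in U | s <= d x + 2]| <= #|M :|: Gp|.
      apply: subset_leq_card; apply/subsetP=> x; rewrite [x \in _ :|: _]inE inE => /andP[xU sx].
      case: (boolP (x \in M)) => //= xM; have xL : x \in L by rewrite inE xM.
      case: (posnP (c x)) => [c0|cx]; last by rewrite inG // cx orbT.
      by rewrite inE xL /r c0; move: sx ps; clear; lia.
    by rewrite cardsU cM; move: c2s Cp ps; clear; lia.
  (* Nothing was laid off outside [Gp]; each member of [Gp] received at most [e.+1 - p], and [l0]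
     strictly less. This bounds [R] from above. *)
  apply: (@clique_arith s e p #|Gp| D R) => //; first by move: CE cE; clear; lia.
  have l0G : l0 \in Gp by rewrite inE l0L /= leqnSn.
  have GL : Gp \subset L by apply/subsetP=> l; rewrite inE => /andP[].
  rewrite RE (big_setID Gp) /= (setIidPr GL) [X in _ + X]big1 ?addn0; last first.
    move=> l /setDP[lL lG]; apply/eqP; rewrite -leqn0 leqNgt.
    by apply: contra lG => cl; rewrite inG // cl orbT.
  rewrite (bigD1 l0) //= [#|Gp|](cardsD1 l0) l0G mulSn -addSn leq_add //.
    by have := cd' _ l0L; have := Ld _ l0L; rewrite /p /r; move: pe; clear; lia.
  rewrite -sum_nat_const [leqRHS](eq_bigl (fun l => (l \in Gp) && (l != l0))); last first.
    by move=> l; rewrite !inE andbC.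
  apply: leq_sum => l /andP[]; rewrite inE => /andP[lL pl] _.
  by have := cd' _ lL; have := Ld _ lL; move: pl; rewrite /r; clear; lia.
have [HL [sHL iHL] dHL] := graphic_near_regular l0max cGp evL.
pose H x y := if x \in M then (if y \in M then x != y else y \in A' x)
  else if y \in M then x \in A' y else HL x y.
have sH : simple_graph H.
  split=> [x y|x]; rewrite /H; last by case: (x \in M); [rewrite eqxx | exact: iHL].
  by case: (x \in M); case: (y \in M) => //; rewrite eq_sym.
have dH x : x \in U -> #|nb U H x| = #|nb U G x|.
  move=> xU; rewrite -/(d x) -(cardsID M); case: (boolP (x \in M)) => xM.
    have -> : nb U H x :&: M = M :\ x.
      apply/setP=> y; rewrite !inE /H xM; case: (boolP (y \in M)) => yM; rewrite ?andbF //.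
      by rewrite (subsetP MU) //= andbT eq_sym andbT.
    have -> : nb U H x :\: M = A' x.
      apply/setP=> y; rewrite !inE /H xM; case: (boolP (y \in M)) => yM /=.
        by apply/esym/negP => /(subsetP (proj1 (A'L _ xM))); rewrite inE yM.
      case yA: (y \in A' x); rewrite ?andbF // andbT.
      by have /(subsetP (proj1 (A'L _ xM))) := yA; rewrite inE => /andP[].
    rewrite (proj2 (A'L _ xM)) /g; have := Md _ xM; have := cardsD1 x M; rewrite xM cM.
    by move: se s0; clear; lia.
  have xL : x \in L by rewrite inE xM.
  have -> : #|nb U H x :&: M| = c x.
    apply: eq_card => y; rewrite !inE /H (negbTE xM) andbC.
    by case: (boolP (y \in M)) => //= yM; rewrite (subsetP MU).
  have -> : #|nb U H x :\: M| = r x.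
    rewrite -dHL //; apply: eq_card => y; rewrite !inE /H (negbTE xM).
    by case: (boolP (y \in M)).
  by have := cd' _ xL; rewrite /r; clear; lia.
have eH := equideg_of_graphic sG sH dH.
exists (fun x y => if (x \in U) && (y \in U) then H x y else G x y), M; split=> //.
by move=> x y xM yM xy; rewrite !(subsetP MU) //= /H xM yM.
Qed.

(* When [C] cannot be moved into the neighbourhood of [v], some [z] in [C] is a non-neighbour
   of [v] with the degree [e] of every neighbour of [v] outside [C]. *)
Lemma extend_clique (V : finType) (U C : {set V}) (G G1 : rel V) (v : V) (s : nat) :
  simple_graph G -> v \in U ->
  (forall x, x \in U -> #|nb U G x| <= #|nb U G v|) ->
  (forall x y, x \in nb U G v -> y \in U -> y \notin nb U G v -> y != v ->
     #|nb U G y| <= #|nb U G x|) ->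
  s <= #|nb U G v| -> equideg (U :\ v) G G1 -> C \subset U :\ v -> #|C| = s ->
  (forall x y, x \in C -> y \in C -> x != y -> G1 x y) ->
  (exists G' (C' : {set V}), [/\ equideg U G G', C' \subset U, #|C'| = s.+1 &
    forall x y, x \in C' -> y \in C' -> x != y -> G' x y]) \/
  (exists e, [/\ e <= #|nb U G v|, #|[set x in U | e < #|nb U G x|]| <= s &
    #|nb U G v| + 2 <= #|[set x in U | e <= #|nb U G x|]|]).
Proof.
move=> [sG iG] vU maxv topv; set N := nb U G v => sN.
have vN : v \notin N by rewrite inE iG andbF.
have NU : N \subset U by apply/subsetP=> x; rewrite inE => /andP[].
have ext (K : {set V}) (H : rel V) : equideg (U :\ v) G H -> K \subset U :\ v -> #|K| = s ->
    (forall x y, x \in K -> y \in K -> x != y -> H x y) -> K \subset N ->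
    exists G' (C' : {set V}), [/\ equideg U G G', C' \subset U, #|C'| = s.+1 &
    forall x y, x \in C' -> y \in C' -> x != y -> G' x y].
  move=> eH KU cK cl KN; have [[sH _] offH _] := eH.
  have vK : v \notin K by apply/negP => /(subsetP KU); rewrite !inE eqxx.
  have vH x : x \in K -> H v x.
    by move=> /(subsetP KN); rewrite offH !inE ?eqxx // => /andP[].
  exists H, (v |: K); split.
  - exact: equideg_sub (subsetDl _ _) eH.
  - by rewrite subUset sub1set vU (subset_trans KU (subsetDl _ _)).
  - by rewrite cardsU1 vK cK.
  move=> x y; rewrite !in_setU1 => /orP[/eqP ->|xK] /orP[/eqP ->|yK] xy.
  - by rewrite eqxx in xy.
  - exact: vH.
  - by rewrite sH; apply: vH.
  - exact: cl.
(* Each shift brings one more clique vertex into [N], so the induction is on the number of those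
   outside. *)
move: {2}#|C :\: N| (leqnn #|C :\: N|) => n; elim: n C G1 => [|n IH] C G1 le eG CU cC cl;
  case: (boolP (C \subset N)) => CN; try by left; apply: ext eG CU cC cl CN.
  by case/negP: CN; rewrite -setD_eq0 -cards_eq0 -leqn0.
have CU' : C \subset U by apply: subset_trans CU (subsetDl _ _).
have vC : v \notin C by apply/negP => /(subsetP CU); rewrite !inE eqxx.
have [[sG1 iG1] offG1 dG1] := eG.
have [z zC zN] := subsetPn CN; have zU := subsetP CU' _ zC.
have zv : z != v by apply: contraNneq vC => <-.
(* Removing [v] costs its neighbours one unit of degree and [z] nothing. Hence a shift can fail
   although every vertex of [N] has at least the degree of [z] in [U]. *)
have dN x : x \in N -> #|nb U G x| = #|nb (U :\ v) G1 x|.+1.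
  move=> xN; have := xN; rewrite inE => /andP[xU vx].
  rewrite (nb_setD1 _ _ vU) sG vx dG1 // !inE xU andbT.
  by apply: contraNneq vN => <-.
have dz : #|nb U G z| = #|nb (U :\ v) G1 z|.
  rewrite (nb_setD1 _ _ vU) sG dG1 ?inE ?zv //.
  by move: zN; rewrite inE zU /= => /negbTE ->.
case: (pickP [pred c in N :\: C | #|nb (U :\ v) G1 z| <= #|nb (U :\ v) G1 c|]) => [c|no].
  rewrite /= inE => /andP[/andP[cC' cN] lec].
  have cv : c != v by apply: contraNneq vN => <-.
  have cUv : c \in U :\ v by rewrite !inE cv (subsetP NU).
  have [G2 [eG2 cl2]] := shift_clique (conj sG1 iG1) CU cl zC cUv cC' lec.
  apply: (IH (c |: (C :\ z)) G2) => //.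
  - have zCN : z \in C :\: N by rewrite inE zN.
    move: le; rewrite (cardsD1 z) zCN add1n ltnS; apply: leq_trans.
    apply: subset_leq_card; apply/subsetP=> x.
    rewrite in_setD in_setU1 !in_setD1 in_setD; case: (eqVneq x c) => [->|_] /=; first by rewrite cN.
    by case: (x \in N); case: (x == z).
  - exact: equideg_trans eG eG2.
  - by rewrite subUset sub1set cUv (subset_trans (subsetDl _ _)).
  - by rewrite cardsU1 !inE (negbTE cC') andbF /= -cC [in RHS](cardsD1 z) zC.
(* Vertices of [N :\: C] have degree at most that of [z], and the other vertices outside [N], except
   [v], have no more. Only [v] and [C :&: N], which misses [z], can exceed it, while [v], [z] and
   all of [N] reach it. *)
right; exists #|nb U G z|; split; first exact: maxv.
  have [c cN cC'] : exists2 c, c \in N & c \notin C.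
    apply/subsetPn; apply: contra zN => NC.
    have /eqP -> : N == C by rewrite eqEcard NC cC.
    exact: zC.
  have ec : #|nb U G c| <= #|nb U G z|.
    by have := negbT (no c); rewrite /= in_setD cC' cN /= -ltnNge dz dN.
  have zCN : z \in C :\: N by rewrite inE zN.
  have : #|[set x in U | #|nb U G z| < #|nb U G x|]| <= #|v |: (C :&: N)|.
    apply: subset_leq_card; apply/subsetP=> x; rewrite in_setU1 in_setI inE => /andP[xU lt].
    case: eqVneq => //= xv.
    case xN: (x \in N); last first.
      by have := topv c x cN xU (negbT xN) xv; move: lt ec; clear; lia.
    rewrite andbT; apply/negPn/negP => xC; have := negbT (no x); rewrite /= in_setD xC xN /=.
    by rewrite -ltnNge -dz; move: lt; rewrite (dN x) //; clear; lia.
  move/leq_trans; apply.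
  have := cardsID N C; have := cardsD1 z (C :\: N); rewrite zCN cC cardsU1.
  by rewrite !inE (negbTE vC) /=; clear; lia.
have -> : #|N| + 2 = #|[set v; z] :|: N|.
  rewrite addnC cardsU cards2 eq_sym zv (_ : [set v; z] :&: N = set0) ?cards0 ?subn0 //.
  apply/setP=> x; rewrite in_setI in_set2 in_set0; case: eqVneq => [->|_] /=; first exact/negbTE.
  by case: eqVneq => [->|] //=; exact/negbTE.
apply: subset_leq_card; apply/subsetP=> x; rewrite in_setU in_set2 inE -orbA.
case/or3P => [/eqP ->|/eqP ->|xN]; first by rewrite vU maxv.
  by rewrite zU leqnn.
by rewrite (subsetP NU) //= topv.
Qed.

(** * Rooted trees *)

(** The value [par r] is arbitrary, so notions about children must exclude [r] explicitly. Only
    differences of depth are prescribed. *)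
Record rooted (V : finType) (T : rel V) (r : V) (par : V -> V) (dep : V -> nat) : Prop :=
  Rooted {
    par_dep : forall x, x != r -> dep x = (dep (par x)).+1;
    par_edge : forall x, x != r -> T x (par x);
    edge_par : forall x y, T x y -> (x != r) && (par x == y) || (y != r) && (par y == x) }.

Definition children (V : finType) (r : V) (par : V -> V) (X : {set V}) : {set V} :=
  [set c | (c != r) && (par c \in X)].

Definition childless (V : finType) (r : V) (par : V -> V) : {set V} :=
  [set x | [forall c, (c != r) ==> (par c != x)]].

Lemma rooted_ind (V : finType) (T : rel V) (r : V) par dep (P : V -> Prop) :
  rooted T r par dep -> P r -> (forall x, x != r -> P (par x) -> P x) -> forall x, P x.
Proof.
move=> rt Pr Pp x; move: {2}(dep x) (leqnn (dep x)) => n.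
elim: n x => [|n IH] x le; have [-> //|xr] := eqVneq x r.
  by move: le; rewrite (par_dep rt xr).
by apply: Pp => //; apply: IH; move: le; rewrite (par_dep rt xr).
Qed.

(** Depth is the distance from [r], and a parent is a neighbour one level up. An edge that joins no
    vertex to its parent could be deleted without disconnecting the graph, so it would close a
    cycle. *)
Lemma tree_rooted (V : finType) (T : rel V) (r : V) :
  is_tree T -> exists par dep, rooted T r par dep.
Proof.
move=> [_ [[sT iT] [cT aT]]].
pose lev := fix lev (n : nat) (x : V) {struct n} : bool :=
  if n is m.+1 then [exists y, lev m y && T y x] else x == r.
have levE x : exists n, lev n x.
  have /connectP[p pp ->] := cT r x.
  elim/last_ind: p pp => [|p z IH]; first by exists 0 => /=.
  rewrite rcons_path last_rcons => /andP[/IH[n ln] Tz].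
  by exists n.+1; apply/existsP; exists (last r p); apply/andP; split.
pose dep x := ex_minn (levE x).
have depP x : lev (dep x) x by rewrite /dep; case: ex_minnP.
have depm n x : lev n x -> dep x <= n by rewrite /dep; case: ex_minnP => m _ H /H.
have parE x : exists y, (x != r) ==> T x y && (dep x == (dep y).+1).
  have [->|xr] := eqVneq x r; first by exists r.
  case dx: (dep x) (depP x) => [|m] /=; first by rewrite (negbTE xr).
  case/existsP=> y /andP[ly Tyx]; exists y; rewrite sT Tyx eqSS eqn_leq (depm _ _ ly) andbT /=.
  by rewrite -ltnS -dx; apply: depm; apply/existsP; exists y; apply/andP; split; [exact: depP|].
pose par x := xchoose (parE x).
have parP x : x != r -> T x (par x) && (dep x == (dep (par x)).+1).
  by move=> xr; exact: (implyP (xchooseP (parE x)) xr).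
exists par, dep.
have pd x : x != r -> dep x = (dep (par x)).+1 by case/parP/andP=> _ /eqP.
have pe x : x != r -> T x (par x) by case/parP/andP.
split=> // x y Txy; apply/negPn/negP; rewrite negb_or => /andP[nx ny].
pose T' := [rel a b | T a b && ~~ ((a == x) && (b == y) || (a == y) && (b == x))].
have sT0 : symmetric T'.
  by move=> a b; rewrite /T' /= sT orbC [(a == y) && _]andbC [(a == x) && _]andbC.
have sT' := sym_connect_sym sT0.
(* The parent edges by themselves form a rooted structure, so [rooted_ind] is available before
   [edge_par] is known for [T]. *)
have rt0 : rooted (fun a b => (a != r) && (par a == b) || (b != r) && (par b == a)) r par dep.
  by split=> // a ar; rewrite ar eqxx.
have conn z : connect T' z r.
  move: z; apply: (rooted_ind (P := fun z => connect T' z r) rt0) => // a ar; apply: connect_trans; apply: connect1 => /=.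
  rewrite pe //=; apply/negP => /orP[] /andP[/eqP ax /eqP pay].
    by case/negP: nx; rewrite -ax ar pay eqxx.
  by case/negP: ny; rewrite -ax ar pay eqxx.
have : connect T' x y by apply: connect_trans (conn x) _; rewrite sT'.
case/connectP=> p0 pp0 ly0; case/shortenP: pp0 ly0 => p pp up _ ly.
have sz : 3 <= size (x :: p).
  case: p pp ly {up} => [|a [|b p]] //=.
    by move=> _ yx; move: Txy; rewrite yx iT.
  by move=> /andP[/andP[_ nn] _] ya; move: nn; rewrite ya !eqxx.
apply: (negP (aT (x :: p) up sz)).
by rewrite /= rcons_path -ly sT Txy andbT; apply: sub_path pp => a b /= /andP[].
Qed.

(** The vertices other than [r] are the children of [X] and those of its complement. The latter are
    at least as many as the vertices outside [X] that have a child. *)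
Lemma card_children_le (V : finType) (r : V) (par : V -> V) (X : {set V}) :
  #|children r par X| < #|X| + #|childless r par|.
Proof.
have H : #|~: X :\: childless r par| <= #|children r par (~: X)|.
  apply: leq_trans (leq_imset_card par _); apply: subset_leq_card; apply/subsetP=> x.
  rewrite !inE negb_forall => /andP[/existsP[c]]; rewrite negb_imply negbK => /andP[cr /eqP pc] xX.
  by apply/imsetP; exists c; rewrite // !inE cr pc.
have E : #|children r par X| + #|children r par (~: X)| = #|V|.-1.
  rewrite -(cardsC1 r) -(cardsID (children r par X) [set~ r]).
  congr (_ + _); apply: eq_card => x; rewrite !inE; case: (x == r) => //=.
  by rewrite andbT.
have := cardsID (childless r par) (~: X); have := cardsC X.
have := subset_leq_card (subsetIr (~: X) (childless r par)).
have : 0 < #|V| by apply/card_gt0P; exists r.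
move: H E; clear; lia.
Qed.

(** Add an outside vertex of least depth: its parent is already inside. *)
Lemma closed_subset (V : finType) (T : rel V) (r : V) par dep (k : nat) :
  rooted T r par dep -> k <= #|V| ->
  exists X : {set V}, #|X| = k /\ forall x, x \in X -> x != r -> par x \in X.
Proof.
move=> rt; elim: k => [|k IH] lt.
  by exists set0; rewrite cards0; split=> // x; rewrite inE.
have [X [cX clX]] := IH (ltnW lt).
have [z0 z0P] : exists z, z \in ~: X.
  by apply/card_gt0P; have := cardsC X; rewrite cX; move: lt; clear; lia.
case: (@arg_minnP _ z0 [pred z | z \in ~: X] dep z0P) => z /= zX zmin.
exists (z |: X); rewrite cardsU1 cX; rewrite inE in zX; split; first by rewrite zX.
move=> x; rewrite !in_setU1 => /orP[/eqP ->|xX] xr; last by rewrite clX ?orbT.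
apply/orP; right; apply/negPn/negP => pX.
by have := zmin (par z); rewrite /= inE pX (par_dep rt xr) ltnn => /(_ isT).
Qed.

(** Depth parity is a proper two-colouring; the larger class within [X] is taken. *)
Lemma parity_class (V : finType) (T : rel V) (r : V) par dep (X : {set V}) :
  rooted T r par dep ->
  exists I : {set V}, [/\ I \subset X, #|X| <= #|I|.*2 &
    forall c, c != r -> par c \in I -> c \notin I].
Proof.
move=> rt.
have H b (I := [set x in X | odd (dep x) == b]) c : c != r -> par c \in I -> c \notin I.
  move=> cr; rewrite !inE (par_dep rt cr) /= => /andP[_ /eqP ->].
  by rewrite negb_and; case: b {I}; rewrite orbT.
have S b : [set x in X | odd (dep x) == b] \subset X.
  by apply/subsetP=> x; rewrite inE => /andP[].
have C : #|[set x in X | odd (dep x) == true]| + #|[set x in X | odd (dep x) == false]| = #|X|.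
  rewrite -(cardsID [set x | odd (dep x)] X); congr (_ + _); apply: eq_card => x; rewrite !inE.
    by rewrite eqb_id.
  by rewrite eqbF_neg andbC.
case: (leqP #|[set x in X | odd (dep x) == true]| #|[set x in X | odd (dep x) == false]|) => le.
  by exists [set x in X | odd (dep x) == false]; split=> //; [rewrite -C; move: le; clear; lia | exact: H].
by exists [set x in X | odd (dep x) == true]; split=> //; [rewrite -C; move: le; clear; lia | exact: H].
Qed.

Lemma par_par_neq (V : finType) (T : rel V) (r : V) par dep (x : V) :
  rooted T r par dep -> x != r -> par x != r -> par (par x) != x.
Proof.
move=> rt.
by move=> xr pr; apply/eqP => e; have := par_dep rt xr; rewrite (par_dep rt pr) e; clear; lia.
Qed.

Lemma leaf_childless (V : finType) (T : rel V) (r : V) par dep (x : V) :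
  symmetric T -> rooted T r par dep -> deg T x = 1 -> x != r -> x \in childless r par.
Proof.
move=> sT rt.
move=> /eqP/cards1P[y Ny] xr; rewrite inE; apply/forallP=> c; apply/implyP=> cr.
apply/eqP => pc.
have N z : T x z -> z = y by move=> xz; apply/set1P; rewrite -Ny inE.
have xc : T x c by rewrite sT -pc; apply: (par_edge rt cr).
have pxr : par c != r by rewrite pc.
have /eqP[] := par_par_neq rt cr pxr.
by rewrite pc (N _ (par_edge rt xr)) (N _ xc).
Qed.

Lemma childless_deg (V : finType) (T : rel V) (r : V) par dep (x : V) :
  rooted T r par dep -> x \in childless r par -> x != r -> deg T x = 1.
Proof.
move=> rt.
rewrite inE => /forallP no xr; apply/eqP/cards1P; exists (par x); apply/setP=> y; rewrite !inE.
apply/idP/eqP => [xy | ->]; last exact: (par_edge rt xr).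
have := edge_par rt xy; rewrite xr => /orP[/eqP // | /andP[yr /eqP py]].
by have := no y; rewrite yr py eqxx.
Qed.

Lemma childless_exists (V : finType) (T : rel V) (r : V) par dep :
  rooted T r par dep -> exists x, x \in childless r par.
Proof.
move=> rt.
case: (@arg_maxnP _ r [pred z : V | true] dep isT) => z _ zmax.
exists z; rewrite inE; apply/forallP=> c; apply/implyP=> cr; apply/eqP=> pc.
by have := zmax c isT; rewrite /= (par_dep rt cr) pc /= ltnn.
Qed.

Lemma root_not_childless (V : finType) (T : rel V) (r : V) par dep :
  rooted T r par dep -> 1 < #|V| -> r \notin childless r par.
Proof.
move=> rt.
move=> /card_gt1P[a [b [_ _ ab]]].
suff [x [xr px]] : exists x, x != r /\ par x = r.
  by rewrite inE; apply/negP => /forallP/(_ x); rewrite xr px eqxx.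
have [z zr] : exists z, z != r.
  by have [e|] := eqVneq a r; [exists b; rewrite -e eq_sym | exists a].
have : (z == r) || [exists x, (x != r) && (par x == r)].
  move: z {zr}; apply: (rooted_ind (P := fun z => (z == r) || [exists x, (x != r) && (par x == r)]) rt); first by rewrite eqxx.
  move=> x xr /orP[px|->]; last by rewrite orbT.
  by apply/orP; right; apply/existsP; exists x; rewrite xr.
by rewrite (negbTE zr) => /existsP[x /andP[xr /eqP px]]; exists x.
Qed.

(** The root is a leaf that has a child. Rooting at a leaf thus saves one childless vertex, which is
    needed for trees with few leaves. *)
Lemma leaf_root_childless (V : finType) (T : rel V) (r : V) par dep :
  rooted T r par dep -> 1 < #|V| -> deg T r = 1 -> #|childless r par| < leaves T.
Proof.
move=> rt.
move=> V1 dr; rewrite /leaves (cardsD1 r [set v | deg T v == 1]) inE dr eqxx add1n ltnS.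
apply: subset_leq_card; apply/subsetP=> x xc; rewrite !inE.
have xr : x != r by apply: contraTneq xc => ->; apply: (root_not_childless rt).
by rewrite xr (childless_deg rt).
Qed.

Lemma leaves_childless (V : finType) (T : rel V) (r : V) par dep :
  symmetric T -> rooted T r par dep -> deg T r != 1 -> leaves T <= #|childless r par|.
Proof.
move=> sT rt.
move=> dr; apply: subset_leq_card; apply/subsetP=> x; rewrite inE => /eqP dx.
by apply: (leaf_childless sT rt dx); apply: contraNneq dr => <-; rewrite dx.
Qed.

Lemma exists_leaf (V : finType) (T : rel V) :
  is_tree T -> 1 < #|V| -> exists x, deg T x = 1.
Proof.
move=> tT V1; have [/card_gt0P[r _] [[sT _] _]] := tT.
have [par [dep rt]] := tree_rooted r tT; have [x xc] := childless_exists rt.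
exists x; apply: (childless_deg rt xc); apply: contraTneq xc => ->.
exact: root_not_childless rt V1.
Qed.

(** If all vertices were leaves, no vertex but the root could have a child, so the root would be
    adjacent to all others. *)
Lemma exists_nonleaf (V : finType) (T : rel V) :
  is_tree T -> 2 < #|V| -> exists x, deg T x != 1.
Proof.
move=> tT V2; have [/card_gt0P[r _] [[sT _] _]] := tT.
have [par [dep rt]] := tree_rooted r tT.
case: (pickP [pred x | deg T x != 1]) => [x xd|no]; first by exists x.
have all1 x : deg T x = 1 by apply/eqP/negbFE/no.
have nc x : x != r -> par x = r.
  move=> xr; apply/eqP/negPn/negP => pr.
  have := leaf_childless sT rt (all1 _) pr; rewrite inE => /forallP/(_ x).
  by rewrite xr eqxx.
have : #|[set~ r]| <= deg T r.
  by apply: subset_leq_card; apply/subsetP=> x; rewrite !inE => xr; rewrite sT -[r in T _ r](nc x) // (par_edge rt).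
by rewrite cardsC1 all1; move: V2; clear; lia.
Qed.

(** * Sequential embedding of a tree *)

(** Members of [I] may go anywhere, the others need a good host in [Gd]. Children are placed
    greedily: one in [I] avoids [Gd] if it can, and any other uses one good host, lowering both
    sides of the supply condition. *)
Lemma place_children (W V : finType) (I P Ch : {set W}) (N Gd : {set V}) (phi : W -> V) :
  {in P &, injective phi} -> [disjoint P & Ch] -> (Gd \subset N) || (N \subset Gd) ->
  #|~: I :\: P| <= #|Gd :\: phi @: P| ->
  (#|W| <= #|N :\: phi @: P| + #|P|) ||
    (Ch \subset ~: I) && ((Gd \subset N) || (#|P :|: Ch| <= #|N :\: phi @: P| + #|P|)) ->
  exists phi' : W -> V,
  [/\ {in P, phi' =1 phi}, {in P :|: Ch &, injective phi'},
      forall c, c \in Ch -> phi' c \in N,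
      forall c, c \in Ch -> c \notin I -> phi' c \in Gd
    & #|~: I :\: (P :|: Ch)| <= #|Gd :\: phi' @: (P :|: Ch)|].
Proof.
move: {2}#|Ch| (erefl #|Ch|) => n; elim: n P Ch phi => [|n IH] P Ch phi cCh inj dis GN cnt av.
  have Ch0 := cards0_eq cCh; exists phi; rewrite Ch0 setU0; split=> // c; rewrite inE //.
have /card_gt0P[c cC] : 0 < #|Ch| by rewrite cCh.
have cP : c \notin P by rewrite (disjointFl dis cC).
have PW : #|P| < #|W|.
  by have := max_card (mem (c |: P)); rewrite cardsU1 cP.
have PC : #|P| < #|P :|: Ch|.
  have -> : #|P|.+1 = #|c |: P| by rewrite cardsU1 cP.
  by apply: subset_leq_card; rewrite setUC; apply: setUS; rewrite sub1set.
have cI : c \in I -> #|W| <= #|N :\: phi @: P| + #|P|.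
  by move=> ci; case/orP: av => // /andP[/subsetP/(_ _ cC)]; rewrite inE ci.
have [s [sN sG cs]] : exists s, [/\ s \in N :\: phi @: P, c \notin I -> s \in Gd &
    #|~: I :\: (c |: P)| <= #|(Gd :\: phi @: P) :\ s|].
  have ne k : 0 < k -> k <= #|N :\: phi @: P| -> exists s, s \in N :\: phi @: P.
    by move=> k0 kN; apply/card_gt0P; apply: leq_trans kN.
  have [cI'|cI'] := boolP (c \in I).
    have cN := cI cI'.
    (* The unplaced vertex [c] lies in [I], so the inequality is strict. This pays for a good host
       when no other kind is free in [N]. *)
    have cIP : #|~: I :\: P| + #|P| < #|W|.
      rewrite -cardsUI (_ : (~: I :\: P) :&: P = set0) ?cards0 ?addn0; last first.
        by apply/setP=> z; rewrite !inE; case: (z \in P); rewrite ?andbF.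
      have := max_card (mem (c |: (~: I :\: P :|: P))).
      by rewrite cardsU1 !inE cI' (negbTE cP).
    have -> : ~: I :\: (c |: P) = ~: I :\: P.
      by apply/setP=> z; rewrite !inE; case: eqVneq => [->|//]; rewrite cI' /= andbF.
    case: (pickP [pred s in N :\: phi @: P | s \notin Gd]) => [s /andP[sN sG]|no].
      exists s; split=> //; rewrite (_ : (Gd :\: _) :\ s = Gd :\: phi @: P) //.
      by apply/setP=> z; rewrite !inE; case: eqVneq => [->|//]; rewrite (negbTE sG) andbF.
    have [s sN] : exists s, s \in N :\: phi @: P.
      by apply/card_gt0P; move: cN PW; clear; lia.
    have sub : N :\: phi @: P \subset Gd :\: phi @: P.
      apply/subsetP=> z zN; have := no z; rewrite inE /= zN => /negbFE zG.
      by move: zN; rewrite !inE zG => /andP[->].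
    exists s; split=> //.
    have := subset_leq_card sub; rewrite [#|Gd :\: _|](cardsD1 s) (subsetP sub _ sN).
    by move: cN cIP; clear; lia.
  have c1 : #|~: I :\: P| = #|~: I :\: (c |: P)|.+1.
    rewrite (cardsD1 c) !inE cP cI' /= add1n; congr _.+1; apply: eq_card => z.
    by rewrite !inE negb_or andbA.
  have [s [sN sG]] : exists s, s \in N :\: phi @: P /\ s \in Gd.
    (* If [Gd] lies in [N], any free good host will do; otherwise every vertex of [N] is good and a
       free one is enough. *)
    have [GN'|GN'] := boolP (Gd \subset N).
      have /card_gt0P[s] : 0 < #|Gd :\: phi @: P| by move: cnt; rewrite c1; clear; lia.
      by rewrite inE => /andP[sP sG]; exists s; rewrite inE sP (subsetP GN').
    have NG : N \subset Gd by move: GN; rewrite (negbTE GN').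
    have /card_gt0P[s sN] : 0 < #|N :\: phi @: P|.
      case/orP: av => [|/andP[_]]; first by move: PW; clear; lia.
      by rewrite (negbTE GN') orFb; move: PC; clear; lia.
    by exists s; split=> //; apply: (subsetP NG); move: sN; rewrite inE => /andP[].
  exists s; split=> //.
  have := cardsD1 s (Gd :\: phi @: P); move: cnt; rewrite c1.
  by case: (s \in _) => /=; clear; lia.
have := sN; rewrite inE => /andP[sP sN'].
pose f x := if x == c then s else phi x.
have fP : {in P, f =1 phi} by move=> x xP; rewrite /f; case: eqVneq xP cP => // -> ->.
have fimg : f @: (c |: P) = s |: phi @: P.
  by rewrite imsetU1 {1}/f eqxx (eq_in_imset fP).
have PE : (c |: P) :|: (Ch :\ c) = P :|: Ch.
  by apply/setP=> z; rewrite !inE; case: eqVneq => [->|_] //=; rewrite cC orbT.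
have cNs : #|N :\: phi @: P| = #|N :\: f @: (c |: P)|.+1.
  rewrite (cardsD1 s) sN add1n; congr _.+1; apply: eq_card => z.
  by rewrite fimg !inE negb_or andbA.
have [||||||f' [f'P inj' f'N f'G cnt']] := IH (c |: P) (Ch :\ c) f.
- by move: cCh; rewrite (cardsD1 c) cC => -[].
- move=> x y; rewrite !in_setU1 => /orP[/eqP ->|xP] /orP[/eqP ->|yP] //.
  + by rewrite {1}/f eqxx (fP y) // => e; case/negP: sP; rewrite e imset_f.
  + by rewrite {2}/f eqxx (fP x) // => e; case/negP: sP; rewrite -e imset_f.
  + by rewrite !fP //; apply: inj.
- rewrite disjoints_subset; apply/subsetP=> z; rewrite !inE => /orP[/eqP ->|zP].
    by rewrite eqxx.
  by rewrite (disjointFr dis zP) andbF.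
- exact: GN.
- by apply: leq_trans cs _; rewrite fimg [s |: _]setUC -setDDl.
- rewrite PE cardsU1 cP; case/orP: av => [av|/andP[CI av]].
    by apply/orP; left; move: av; rewrite cNs; clear; lia.
  apply/orP; right; rewrite (subset_trans (subsetDl _ _) CI) /=.
  by case/orP: av => [->//|av]; apply/orP; right; move: av; rewrite cNs; clear; lia.
rewrite PE in inj' cnt'; exists f'; split=> //.
- by move=> x xP; rewrite f'P ?inE ?xP ?orbT // fP.
- move=> z zC; have [->|zc] := eqVneq z c; last by apply: f'N; rewrite !inE zc.
  by rewrite f'P ?setU11 // /f eqxx.
- move=> z zC zI; have [e|zc] := eqVneq z c; last by apply: f'G; rewrite ?inE ?zc.
  by rewrite e f'P ?setU11 // /f eqxx; apply: sG; rewrite -e.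
Qed.

(* [Q] is the set of processed tree vertices; their children are placed as well, and the
   graph may still be altered only on the set [U :\: phi @: Q] of unprocessed vertices. *)
Record partial_embedding (W V : finType) (r : W) (par : W -> W) (U : {set V}) (G : rel V)
    (tau : nat) (I X Q : {set W}) (G' : rel V) (phi : W -> V) : Prop := PartialEmbedding {
  pe_equideg : equideg U G G';
  pe_inj : {in r |: children r par Q &, injective phi};
  pe_in : forall x, x \in r |: children r par Q -> phi x \in U;
  pe_edge : forall c, c \in children r par Q -> G' (phi (par c)) (phi c);
  pe_good : forall x, x \in (r |: children r par Q) :\: Q -> x \notin I ->
    tau <= #|nb (U :\: phi @: Q) G' (phi x)| + #|Q|;
  pe_supply : #|~: I :\: (r |: children r par Q)| <=
    #|[set u in U :\: phi @: Q | tau <= #|nb (U :\: phi @: Q) G' u| + #|Q|]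
        :\: phi @: (r |: children r par Q)|;
  pe_early : (Q \subset X) || (X \subset Q);
  pe_sub : Q \subset r |: children r par Q }.

Lemma partial_embedding_start (W V : finType) (r : W) (par : W -> W) (U : {set V}) (G : rel V)
    (tau : nat) (I X : {set W}) :
  simple_graph G -> #|W| <= #|U| -> #|~: I| <= #|[set u in U | tau <= #|nb U G u|]| ->
  exists G' phi, partial_embedding r par U G tau I X set0 G' phi.
Proof.
(* The vertex [v0] is a mere default value for the map before anything is placed. *)
move=> sG WU cI; have [v0 v0U] : exists v, v \in U.
  by apply/card_gt0P; apply: leq_trans WU; apply/card_gt0P; exists r.
have [||||| phi [_ inj inU inG cnt]] :=
  @place_children W V I set0 [set r] U [set u in U | tau <= #|nb U G u|] (fun=> v0).
- by move=> x; rewrite inE.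
- by rewrite -setI_eq0 set0I.
- by apply/orP; left; apply/subsetP=> u; rewrite inE => /andP[].
- by rewrite imset0 !setD0.
- by rewrite imset0 setD0 cards0 addn0 WU.
rewrite set0U in inj cnt.
have ch0 : r |: children r par set0 = [set r].
  by apply/setP=> x; rewrite !inE andbF orbF.
exists G, phi; split; rewrite ?ch0 ?imset0 ?setD0 ?cards0 ?sub0set //.
- by move=> c; rewrite !inE andbF.
- by move=> x xr xI; rewrite addn0; have := inG x xr xI; rewrite inE => /andP[].
- apply: leq_trans cnt _; apply: subset_leq_card; apply: setSD; apply/subsetP=> u.
  by rewrite !inE addn0.
Qed.

(** Take an unprocessed vertex of least depth, inside [X] as long as [X] is not exhausted; its
    parent has been processed. *)
Lemma partial_embedding_next (W : finType) (T : rel W) (r : W) par dep (X Q : {set W}) :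
  rooted T r par dep -> (forall x, x \in X -> x != r -> par x \in X) ->
  (Q \subset X) || (X \subset Q) -> Q != setT ->
  exists x, [/\ x \in r |: children r par Q, x \notin Q,
    x \in X -> Q \subset X & (x |: Q \subset X) || (X \subset x |: Q)].
Proof.
move=> rt clX QX QT.
pose Y := if X \subset Q then ~: Q else X :\: Q.
have /set0Pn[z0 z0Y] : Y != set0.
  rewrite /Y; case: ifP => [_|/negbT]; last by rewrite -setD_eq0.
  by apply: contra QT => /eqP e; rewrite -[Q]setCK e setC0.
case: (@arg_minnP _ z0 [pred z | z \in Y] dep z0Y) => x /= xY xmin.
have xQ : x \notin Q by move: xY; rewrite /Y; case: ifP; rewrite !inE // => _ /andP[].
exists x; split=> //.
- rewrite in_setU1; case: eqVneq => //= xr; rewrite inE xr /=.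
  apply/negPn/negP => pQ; have := xmin (par x); rewrite /= (par_dep rt xr) ltnn.
  suff -> : par x \in Y by move=> /(_ isT).
  move: xY; rewrite /Y; case: ifP => _; rewrite !inE (negbTE pQ) //= => /andP[_ xX].
  exact: clX.
- by move=> xX; case/orP: QX => // /subsetP/(_ _ xX); rewrite (negbTE xQ).
move: xY; rewrite /Y; case: (boolP (X \subset Q)) => XQ.
  by move=> _; apply/orP; right; apply: subset_trans XQ (subsetU1 _ _).
rewrite inE => /andP[_ xX]; rewrite subUset sub1set xX.
by case/orP: QX => [->|XQ'] //; rewrite XQ' in XQ.
Qed.

(** After [phi x] is laid off, its neighbourhood [N] has the largest remaining degrees. It is
    therefore comparable under inclusion with the set [Gd] of good hosts, as [place_children]
    requires. *)
Lemma partial_embedding_step (W V : finType) (T : rel W) (r : W) par dep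
    (U : {set V}) (G : rel V) (tau delta : nat) (I X Q : {set W}) G' phi :
  rooted T r par dep -> #|W| <= tau.+1 ->
  (forall u, u \in U -> delta <= #|nb U G u|) ->
  (forall c, c != r -> par c \in I -> c \notin I /\
    (#|U| <= tau.+1 \/ par c \in X /\ #|X| + #|childless r par| <= delta.+1)) ->
  (forall x, x \in X -> x != r -> par x \in X) ->
  partial_embedding r par U G tau I X Q G' phi -> Q != setT ->
  exists x G'' phi', x \notin Q /\ partial_embedding r par U G tau I X (x |: Q) G'' phi'.
Proof.
move=> rt Wtau dG HI clX [eG inj inU edge good supply early QP] QT.
have [x [xP xQ xX early']] := partial_embedding_next rt clX early QT.
move: inj inU good supply QP xP; set P := r |: children r par Q => inj inU good supply QP xP.
pose A := U :\: phi @: Q; rewrite -/A in good supply.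
have [sG' offG' dG'] := eG.
have oA : phi x \in A.
  rewrite inE inU // andbT; apply/imsetP => -[y yQ e].
  by move: xQ; rewrite (inj _ _ xP (subsetP QP _ yQ) e) yQ.
have [G2 [eG2 top]] := lay_off sG' oA; have [sG2 offG2 dG2] := eG2.
have AU : A \subset U := subsetDl _ _.
have eGG2 : equideg U G G2 := equideg_trans eG (equideg_sub AU eG2).
have oN : phi x \notin nb A G2 (phi x) by rewrite inE (proj2 sG2) andbF.
pose N := nb A G2 (phi x); rewrite -/N in top oN.
have NA : N \subset A by apply/subsetP=> u; rewrite inE => /andP[].
pose Gd := [set u in A :\ phi x | tau <= #|nb A G' u| + #|Q|].
have GN : (Gd \subset N) || (N \subset Gd).
  have [//|/subsetPn[u uG uN]] := boolP (Gd \subset N); apply/subsetP=> w wN.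
  have := uG; rewrite inE in_setD1 => /andP[/andP[uo uA] tu].
  have wo : w != phi x by apply: contraNneq oN => <-.
  rewrite inE in_setD1 wo (subsetP NA _ wN); apply: leq_trans tu _.
  by rewrite leq_add2r; apply: top.
pose Ch := children r par [set x].
have ChE c : (c \in Ch) = (c != r) && (par c == x) by rewrite inE in_set1.
have PCh : P :|: Ch = r |: children r par (x |: Q).
  by apply/setP=> c; rewrite !inE; case: (c == r) => //=; rewrite orbC.
have dis : [disjoint P & Ch].
  rewrite -setI_eq0; apply/eqP/setP=> c; rewrite in_setI ChE in_set0 !inE.
  by case: (c == r) => //=; case: eqP => [->|]; rewrite ?andbF // (negbTE xQ).
have supply' : #|~: I :\: P| <= #|Gd :\: phi @: P|.
  apply: leq_trans supply _; apply: subset_leq_card; apply/subsetP=> u.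
  rewrite in_setD inE => /and3P[uP uA tu]; rewrite in_setD uP inE in_setD1 uA tu /= !andbT.
  by apply: contraNneq uP => ->; apply: imset_f.
have cPQ : #|(P :\: Q) :\ x| + #|Q| + 1 = #|P|.
  rewrite -(cardsID Q P) (setIidPr QP) [#|P :\: Q|](cardsD1 x) inE xQ xP; clear; lia.
(* Processed images have left [A], and [phi x] is not its own neighbour, so only the remaining
   placed vertices can occupy [N]. *)
have cN : #|N| + #|Q| + 1 <= #|N :\: phi @: P| + #|P|.
  have : #|N :&: phi @: P| <= #|(P :\: Q) :\ x|.
    apply: leq_trans (leq_imset_card phi _); apply: subset_leq_card; apply/subsetP=> u.
    rewrite inE => /andP[uN /imsetP[y yP uy]]; rewrite uy; apply: imset_f.
    rewrite in_setD1 in_setD yP andbT; apply/andP; split; first by apply: contraNneq oN => <-; rewrite -uy.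
    have := subsetP NA _ uN; rewrite in_setD uy => /andP[nQ _].
    by apply: contra nQ => yQ; apply: imset_f.
  by have := cardsID (phi @: P) N; move: cPQ; clear; lia.
have av : (#|W| <= #|N :\: phi @: P| + #|P|) ||
    (Ch \subset ~: I) && ((Gd \subset N) || (#|P :|: Ch| <= #|N :\: phi @: P| + #|P|)).
  have [xI|xI] := boolP (x \in I); last first.
    apply/orP; left; have : tau <= #|nb A G' (phi x)| + #|Q| by apply: good; rewrite // in_setD xQ.
    by rewrite -dG2 // -/N; move: cN Wtau; clear; lia.
  apply/orP; right; case: (pickP (mem Ch)) => [c cCh|no]; last first.
    have -> : Ch = set0 by apply/setP=> c; rewrite in_set0; exact: no.
    by rewrite sub0set setU0 leq_addl orbT.
  have := cCh; rewrite /= ChE => /andP[cr /eqP pc].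
  apply/andP; split.
    apply/subsetP=> d; rewrite ChE inE => /andP[dr /eqP pd].
    by case: (HI d dr); rewrite ?pd.
  have [] := HI c cr; rewrite pc // => _ [Ut|[xX' Xd]]; apply/orP.
    (* As [#|U| <= tau.+1], a good host is adjacent to every other vertex of [A], in particular to
       [phi x]. *)
    left; apply/subsetP=> u uG; have := uG; rewrite inE in_setD1 => /andP[/andP[uo uA] tu].
    have cA : #|A| + #|Q| = #|U|.
      rewrite -(cardsID (phi @: Q) U) addnC (setIidPr _); last first.
        by apply/subsetP=> w /imsetP[y yQ ->]; apply: inU; apply: (subsetP QP).
      by rewrite card_in_imset // => a b aQ bQ; apply: inj; apply: (subsetP QP).
    have cAu := cardsD1 u A; rewrite uA in cAu.
    have sub : nb A G2 u \subset A :\ u.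
      apply/subsetP=> w; rewrite inE in_setD1 => /andP[-> uw]; rewrite andbT.
      by apply: contraTneq uw => ->; rewrite (proj2 sG2).
    have /setP/(_ (phi x)) : nb A G2 u = A :\ u.
      apply/eqP; rewrite eqEcard sub dG2 //.
      by move: cA tu Ut cAu; clear; lia.
    rewrite inE in_setD1 oA eq_sym uo /= => Gu.
    by rewrite inE uA (proj1 sG2) Gu.
  (* Everything processed so far lies in [X], so the placed vertices and new children number at most
     [#|X| + #|childless r par|]. The minimum degree [delta] leaves room for them. *)
  right; have := card_children_le r par X; have dN : delta <= #|N| + #|Q|.
    apply: leq_trans (dG _ (subsetP AU _ oA)) _; have [_ _ dGG2] := eGG2.
    rewrite -(dGG2 _ (subsetP AU _ oA)) -(cardsID (phi @: Q)) addnC leq_add //.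
      by apply: subset_leq_card; apply/subsetP=> w; rewrite !inE => /and3P[-> -> ->].
    by apply: leq_trans (leq_imset_card phi Q); apply: subset_leq_card; apply: subsetIr.
  have : #|P :|: Ch| <= #|children r par X|.+1.
    rewrite PCh; apply: leq_trans (_ : #|r |: children r par X| <= _); last first.
      by rewrite cardsU1; case: (_ \notin _) => //=; clear; lia.
    apply: subset_leq_card; apply: setUS; apply/subsetP=> d; rewrite !inE => /andP[-> /=].
    by case/orP => [/eqP ->//|]; apply: (subsetP (xX xX')).
  by move: cN dN Xd; clear; lia.
have [phi' [eqf inj' inN inG cnt]] := place_children inj dis GN supply' av.
have eqQ y : y \in Q -> phi' y = phi y by move=> /(subsetP QP); apply: eqf.
have eqx : phi' x = phi x by apply: eqf.
have A' : U :\: phi' @: (x |: Q) = A :\ phi x.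
  by rewrite imsetU1 eqx (eq_in_imset eqQ) setUC -setDDl.
have cQ : #|x |: Q| = #|Q|.+1 by rewrite cardsU1 xQ.
(* Processing a vertex costs at most one unit of remaining degree, which the growth of [#|Q|]
   compensates. *)
have nbA u : u \in A -> #|nb A G' u| <= #|nb (A :\ phi x) G2 u|.+1.
  by move=> uA; rewrite -dG2 // (nb_setD1 _ _ oA); case: (G2 _ _).
exists x, G2, phi'; split=> //; split; rewrite -?PCh ?A' ?cQ //.
- move=> y; rewrite in_setU => /orP[yP|/inN yN]; first by rewrite eqf // inU.
  exact: subsetP AU _ (subsetP NA _ yN).
- move=> c; rewrite inE in_setU1 => /andP[cr /orP[/eqP pc|pQ]].
    have : phi' c \in N by apply: inN; rewrite ChE cr pc eqxx.
    by rewrite inE pc eqx => /andP[].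
  have cQ' : c \in children r par Q by rewrite inE cr pQ.
  rewrite eqQ // eqf ?in_setU1 ?cQ' ?orbT //.
  rewrite offG2; first exact: edge.
  by rewrite negb_and inE imset_f.
- move=> y; rewrite in_setD in_setU1 negb_or in_setU => /andP[/andP[yx yQ] yPC] yI.
  suff H : phi' y \in A /\ tau <= #|nb A G' (phi' y)| + #|Q|.
    by case: H => /nbA; clear; lia.
  case/orP: yPC => [yP|yC].
    rewrite eqf //; split; last by apply: good; rewrite // in_setD yQ.
    rewrite in_setD inU // andbT; apply/imsetP => -[z zQ e].
    by move: yQ; rewrite (inj _ _ yP (subsetP QP _ zQ) e) zQ.
  by have := inG _ yC yI; rewrite inE => /andP[/setD1P[_ yA] ty]; split.
- apply: leq_trans cnt _; apply: subset_leq_card; apply: setSD; apply/subsetP=> u uG.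
  have [/setD1P[uo uA] tu] : u \in A :\ phi x /\ tau <= #|nb A G' u| + #|Q|.
    by apply/andP; move: uG; rewrite inE.
  rewrite inE in_setD1 uo uA /=.
  by have := nbA u uA; move: tu; clear; lia.
- rewrite subUset sub1set in_setU xP /=; apply: subset_trans QP (subsetUl _ _).
Qed.

(** Vertices outside [I] get hosts of degree at least [tau]. A member of [I] with children may have
    a poor host: its children fit either because good hosts are dominating, or because it belongs to
    the small set [X] processed first. *)
Lemma sequential_embedding (W V : finType) (T : rel W) (r : W) par dep
    (U : {set V}) (G : rel V) (tau delta : nat) (I X : {set W}) :
  rooted T r par dep -> simple_graph G -> #|W| <= #|U| -> #|W| <= tau.+1 ->
  #|~: I| <= #|[set u in U | tau <= #|nb U G u|]| ->
  (forall u, u \in U -> delta <= #|nb U G u|) ->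
  (forall c, c != r -> par c \in I -> c \notin I /\
    (#|U| <= tau.+1 \/ par c \in X /\ #|X| + #|childless r par| <= delta.+1)) ->
  (forall x, x \in X -> x != r -> par x \in X) ->
  exists G' phi, [/\ equideg U G G', injective phi, forall x, phi x \in U &
    forall x y, T x y -> G' (phi x) (phi y)].
Proof.
move=> rt sG WU Wtau cI dG HI clX.
suff H n Q G' phi : #|~: Q| <= n -> partial_embedding r par U G tau I X Q G' phi ->
    exists G' phi, [/\ equideg U G G', injective phi, forall x, phi x \in U &
      forall x y, T x y -> G' (phi x) (phi y)].
  have [G' [phi pe]] := partial_embedding_start r par X sG WU cI.
  exact: H (leqnn _) pe.
have fin (G1 : rel V) f : partial_embedding r par U G tau I X setT G1 f ->
    exists G' phi, [/\ equideg U G G', injective phi, forall x, phi x \in U &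
      forall x y, T x y -> G' (phi x) (phi y)].
  case=> eG inj inU edge _ _ _ /subsetP all; have [[sG1 _] _ _] := eG.
  exists G1, f; split=> //.
  - by move=> x y; apply: inj; apply: all; rewrite inE.
  - by move=> x; apply: inU; apply: all; rewrite inE.
  move=> x y /(edge_par rt)/orP[] /andP[cr /eqP <-]; last by apply: edge; rewrite !inE cr.
  by rewrite sG1; apply: edge; rewrite !inE cr.
elim: n Q G' phi => [|n IH] Q G' phi le pe; have [QT|QT] := eqVneq Q setT;
  try by rewrite QT in pe; exact: fin pe.
  by case/negP: QT; rewrite -[Q]setCK; move: le; rewrite leqn0 cards_eq0 => /eqP ->; rewrite setC0.
have [x [G2 [phi2 [xQ pe2]]]] := partial_embedding_step rt Wtau dG HI clX pe QT.
apply: IH pe2; move: le; rewrite (cardsD1 x) inE xQ add1n ltnS; apply: leq_trans.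
by apply: subset_leq_card; apply/subsetP=> y; rewrite !inE negb_or.
Qed.

(** * Clique or tree in the complement *)

Definition compl_graph (V : finType) (G : rel V) : rel V := fun x y => (x != y) && ~~ G x y.

Lemma compl_graph_simple (V : finType) (G : rel V) :
  simple_graph G -> simple_graph (compl_graph G).
Proof.
move=> [sG _]; split=> [x y|x]; rewrite /compl_graph; first by rewrite eq_sym sG.
by rewrite eqxx.
Qed.

Lemma nb_compl_graph (V : finType) (U : {set V}) (G : rel V) (x : V) :
  simple_graph G -> x \in U -> #|nb U (compl_graph G) x| = #|U| - #|nb U G x|.+1.
Proof.
move=> [_ iG] xU; have <- : #|x |: nb U G x| = #|nb U G x|.+1.
  by rewrite cardsU1 inE iG andbF.
have sub : x |: nb U G x \subset U.
  by rewrite subUset sub1set xU; apply/subsetP=> y; rewrite inE => /andP[].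
rewrite -cardsDS //; apply: eq_card => y.
by rewrite !inE /compl_graph negb_or eq_sym; case: (y \in U); rewrite ?andbF ?andbT.
Qed.

Lemma equideg_compl_graph (V : finType) (U : {set V}) (G H : rel V) :
  simple_graph G -> equideg U (compl_graph G) H -> equideg U G (compl_graph H).
Proof.
move=> sG [sH offH dH]; split=> [|x y xy|x xU]; first exact: compl_graph_simple.
  rewrite /compl_graph offH // /compl_graph negb_and !negbK.
  by have [<-|] := eqVneq x y; rewrite ?(proj2 sG).
have sub : #|nb U G x| < #|U|.
  rewrite [#|U|](cardsD1 x) xU add1n ltnS; apply: subset_leq_card; apply/subsetP=> y.
  by rewrite !inE => /andP[->]; case: eqVneq => // ->; rewrite (proj2 sG).
by rewrite nb_compl_graph // dH // nb_compl_graph //; move: sub; clear; lia.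
Qed.

Definition has_clique (V : finType) (U : {set V}) (G : rel V) (s : nat) : Prop :=
  exists G' (C : {set V}), [/\ equideg U G G', C \subset U, #|C| = s &
    forall x y, x \in C -> y \in C -> x != y -> G' x y].

Definition has_anticopy (W V : finType) (T : rel W) (U : {set V}) (G : rel V) : Prop :=
  exists G' phi, [/\ equideg U G G', injective phi, forall x, phi x \in U &
    forall x y, T x y -> ~~ G' (phi x) (phi y)].

(** [sequential_embedding] in the complement. The condition [#|nb U G u| + tau < #|U|] says, without
    truncated subtraction, that the complementary degree is at least [tau]. *)
Lemma has_anticopy_tree (W V : finType) (T : rel W) (r : W) par dep
    (U : {set V}) (G : rel V) (tau delta : nat) (I X : {set W}) :
  rooted T r par dep -> simple_graph G -> #|W| <= #|U| -> #|W| <= tau.+1 ->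
  #|~: I| <= #|[set u in U | #|nb U G u| + tau < #|U|]| ->
  (forall u, u \in U -> #|nb U G u| + delta < #|U|) ->
  (forall c, c != r -> par c \in I -> c \notin I /\
    (#|U| <= tau.+1 \/ par c \in X /\ #|X| + #|childless r par| <= delta.+1)) ->
  (forall x, x \in X -> x != r -> par x \in X) ->
  has_anticopy T U G.
Proof.
move=> rt sG WU Wt cI dG HI clX.
have [|||G' [phi [eG inj inU edge]]] :=
  @sequential_embedding _ _ _ _ _ _ U (compl_graph G) tau delta I X rt _ WU Wt _ _ HI clX.
- exact: compl_graph_simple.
- apply: leq_trans cI _; apply: subset_leq_card; apply/subsetP=> u.
  rewrite !inE => /andP[uU lt]; rewrite uU nb_compl_graph //=.
  by move: lt; clear; lia.
- by move=> u uU; rewrite nb_compl_graph //; have := dG _ uU; clear; lia.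
exists (compl_graph G'), phi; split=> //; first exact: equideg_compl_graph.
by move=> x y /edge xy; rewrite /compl_graph xy andbF.
Qed.

Lemma card_deg_split (V : finType) (U : {set V}) (f : V -> nat) (k : nat) :
  #|[set u in U | f u < k]| + #|[set u in U | k <= f u]| = #|U|.
Proof.
rewrite -(cardsID [set u | f u < k] U); congr (_ + _); apply: eq_card => u; rewrite !inE //.
by rewrite -leqNgt andbC.
Qed.

Lemma childless_no_child (V : finType) (r : V) (par : V -> V) (c : V) :
  c != r -> par c \notin childless r par.
Proof. by move=> cr; rewrite inE; apply/negP => /forallP/(_ c); rewrite cr eqxx. Qed.

(** With [I] the childless vertices, the condition on parents in [I] is vacuous. *)
Lemma has_anticopy_dense (W V : finType) (T : rel W) (U : {set V}) (G : rel V) (tau : nat) (r : W) :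
  is_tree T -> simple_graph G -> #|W| <= #|U| -> #|W| <= tau.+1 ->
  (forall par dep, rooted T r par dep ->
    #|W| - #|childless r par| <= #|[set u in U | #|nb U G u| + tau < #|U|]|) ->
  has_anticopy T U G.
Proof.
move=> tT sG WU Wt HI; have [par [dep rt]] := tree_rooted r tT.
apply: (@has_anticopy_tree _ _ _ _ _ _ U G tau 0 (childless r par) set0 rt) => //.
- by rewrite cardsCs setCK; apply: HI rt.
- move=> u uU; rewrite addn0 [#|U|](cardsD1 u) uU add1n ltnS; apply: subset_leq_card.
  by apply/subsetP=> y; rewrite !inE => /andP[->]; case: eqVneq => // ->; rewrite (proj2 sG).
- by move=> c /(childless_no_child par)/negbTE ->.
- by move=> x; rewrite inE.
Qed.

Lemma has_anticopy_lift (W V : finType) (T : rel W) (U U' : {set V}) (G G1 : rel V) :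
  U' \subset U -> equideg U G G1 -> has_anticopy T U' G1 -> has_anticopy T U G.
Proof.
move=> sU eG [G' [phi [eG' inj inU edge]]]; exists G', phi; split=> //.
  exact: equideg_trans eG (equideg_sub sU eG').
by move=> x; apply: (subsetP sU).
Qed.

Lemma has_clique_lift (V : finType) (U : {set V}) (G G1 : rel V) (s : nat) :
  equideg U G G1 -> has_clique U G1 s -> has_clique U G s.
Proof.
move=> eG [G' [C [eG' CU cC cl]]]; exists G', C; split=> //.
exact: equideg_trans eG eG'.
Qed.

(* In the proofs below, [cardsT] gives lia a single atom for [#|W|], which otherwise occurs in two
   convertible but syntactically different forms. *)
Lemma has_anticopy_few_leaves (W V : finType) (T : rel W) (U : {set V}) (G : rel V) (k : nat) :
  is_tree T -> simple_graph G -> #|U| = #|W| + k.-1 -> 1 < k -> 7 * k.-1 < #|W| ->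
  leaves T <= k.+1 ->
  k < #|[set u in U | k <= #|nb U G u|]| ->
  #|[set u in U | k <= #|nb U G u|.+1]| <= k.*2.+1 ->
  (forall u, u \in U -> #|nb U G u| + 2 <= #|[set u in U | k <= #|nb U G u|]|) ->
  has_anticopy T U G.
Proof.
move=> tT sG cU k1 kW lk; set q := #|[set u in U | k <= #|nb U G u|]| => kq q2 dq.
have WU : #|W| <= #|U| by rewrite cU leq_addr.
have q2' : q <= k.*2.+1.
  apply: leq_trans q2; apply: subset_leq_card; apply/subsetP=> u; rewrite !inE.
  by case: (u \in U) => //= /leqW.
have [/card_gt0P[r0 _] [[sT _] _]] := tT.
have k7 : 1 <= 7 * k.-1 by move: k1; rewrite -?(cardsT W); clear; lia.
have W1 := leq_ltn_trans k7 kW.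
have [k2|k3] := leqP k 2.
  have kE : k = 2 by move: k1 k2; rewrite -?(cardsT W); clear; lia.
  have [par [dep rt]] := tree_rooted r0 tT.
  have [I [_ cI indI]] := parity_class setT rt.
  (* Since [#|U| = #|W| + 1], the good hosts are the isolated vertices of [G]. At most five vertices
     are not isolated, and [7 < #|W|] lets the tree vertices outside [I] fit on the rest. *)
  apply: (@has_anticopy_tree _ _ _ _ _ _ U G #|W| 0 I set0 rt) => //.
  - have -> : [set u in U | #|nb U G u| + #|W| < #|U|] = [set u in U | #|nb U G u|.+1 < k].
      apply/setP=> u; rewrite !inE cU kE; case: (u \in U) => //=.
      by apply/idP/idP; rewrite -?(cardsT W); clear; lia.
    have /= := card_deg_split U (fun u => #|nb U G u|.+1) k; have := cardsC I; rewrite cardsT in cI.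
    by move: cI q2 kW; rewrite cU kE -?(cardsT W); clear; lia.
  - move=> u uU; have := dq u uU; have : q <= #|U|; last by rewrite -?(cardsT W); clear; lia.
    by apply: subset_leq_card; apply/subsetP=> y; rewrite inE => /andP[].
  - move=> c cr /(indI c cr) ->; split=> //; left.
    by rewrite cU kE; rewrite -?(cardsT W); clear; lia.
  - by move=> x; rewrite inE.
have [r dr] := exists_leaf tT W1; have [par [dep rt]] := tree_rooted r tT.
have cl : #|childless r par| <= k.
  by rewrite -ltnS; apply: leq_trans (leaf_root_childless rt W1 dr) lk.
(* Complementary degrees are at least [delta = #|W| + k - q], and there are at most [k] childless
   vertices. The size of [X] is the largest for which [#|X| + k <= delta.+1]. *)
have [|X [cX clX]] := @closed_subset _ _ _ _ _ (#|W|.+1 - q) rt.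
  by move: kq; rewrite -?(cardsT W); clear; lia.
have [I [IX cI indI]] := parity_class X rt.
apply: (@has_anticopy_tree _ _ _ _ _ _ U G #|W|.-1 (#|W| + k - q) I X rt) => //.
- exact: leqSpred.
- have -> : [set u in U | #|nb U G u| + #|W|.-1 < #|U|] = [set u in U | #|nb U G u| < k].
    apply/setP=> u; rewrite !inE cU; case: (u \in U) => //=.
    by apply/idP/idP; move: W1 k1; rewrite -?(cardsT W); clear; lia.
  (* There are [#|U| - q] good hosts, so [I] must absorb [q - k + 1] tree vertices. Half of
     [#|W|.+1 - q] is enough, as [q <= k.*2.+1] and [7 * k.-1 < #|W|]. *)
  have /= := card_deg_split U (fun u => #|nb U G u|) k; have := cardsC I; rewrite -/q.
  by rewrite cX in cI; move: cI kq q2' kW k3; rewrite cU -?(cardsT W); clearbody q; clear; lia.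
- by move=> u /dq; rewrite -/q cU; move: q2' kW k3; rewrite -?(cardsT W); clearbody q; clear; lia.
- move=> c cr pc; split; first exact: indI.
  right; split; first exact: (subsetP IX).
  by rewrite cX; move: cl kq q2' kW k3; rewrite -?(cardsT W); clearbody q; clear; lia.
Qed.

(** Stated for every subset [U], because the induction passes to [U :\ v] in the same ambient graph
    and lifts the exchanges made there. *)
Lemma clique_or_anticopy (W : finType) (T : rel W) (s : nat) :
  is_tree T -> 2 <= s -> s.+1 <= leaves T \/ 7 * (s - 2) < #|W| ->
  forall (V : finType) (U : {set V}) (G : rel V),
    simple_graph G -> #|U| = #|W| + s - 2 -> has_clique U G s \/ has_anticopy T U G.
Proof.
move=> tT s2; have [W0 [[sT _] _]] := tT; have /card_gt0P[r0 _] := W0.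
case: s s2 => // k; rewrite ltnS => k1; elim: k k1 => // k IH _ hyp V U G sG cU.
have [k0|k1] := posnP k.
  move: cU; rewrite k0 addnK => cU.
  case: (pickP [pred p : V * V | [&& p.1 \in U, p.2 \in U & G p.1 p.2]]) => [[x y] /= /and3P[xU yU xy]|no].
    have nxy : x != y by apply: contraTneq xy => ->; rewrite (proj2 sG).
    left; exists G, [set x; y]; split; [exact: equideg_refl| |by rewrite cards2 nxy|].
      by apply/subsetP=> z; rewrite !inE => /orP[] /eqP ->.
    move=> a b; rewrite !inE => /orP[] /eqP -> /orP[] /eqP ->; rewrite ?eqxx //.
    by rewrite (proj1 sG).
  (* Without edges inside [U], the complement on [U] is complete. *)
  right; apply: (has_anticopy_dense (tau := #|W|.-1) (r := r0) tT sG); first by rewrite cU.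
    exact: leqSpred.
  move=> par dep rt; apply: leq_trans (leq_subr _ _) _; rewrite -cU; apply: subset_leq_card.
  apply/subsetP=> u uU; rewrite inE uU /= (_ : #|nb U G u| = 0); last first.
    by apply: eq_card0 => y; have := no (u, y); rewrite !inE /= uU /=.
  by rewrite cU prednK.
have cU' : #|U| = #|W| + k by move: cU; rewrite -?(cardsT W); clear; lia.
have WU : #|W| <= #|U| by rewrite cU' leq_addr.
have hypk : k.+2 <= leaves T \/ 7 * (k.+1 - 2) < #|W|.
  by case: hyp => h; [left; apply: ltnW | right; apply: leq_ltn_trans h; rewrite -?(cardsT W); clear; lia].
set q := #|[set u in U | k.+1 <= #|nb U G u|]|.
have splitU := card_deg_split U (fun u => #|nb U G u|) k.+1; rewrite -/q in splitU.
have [qk|kq] := leqP q k.+1.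
  (* At least [#|W| - 1] hosts have complementary degree [#|W| - 1] or more, and at least one tree
     vertex is childless. *)
  right; apply: (has_anticopy_dense (tau := #|W|.-1) (r := r0) tT sG) => //; first exact: leqSpred.
  move=> par dep rt; have [x xc] := childless_exists rt.
  have c0 : 0 < #|childless r0 par| by apply/card_gt0P; exists x.
  have <- : [set u in U | #|nb U G u| < k.+1] = [set u in U | #|nb U G u| + #|W|.-1 < #|U|].
    by apply/setP=> u; rewrite !inE cU'; case: (u \in U) => //=; apply/idP/idP; move: W0; rewrite -?(cardsT W); clear; lia.
  by move: splitU qk c0 W0; rewrite cU'; rewrite -?(cardsT W); clear; lia.
have [v0 v0U] : exists v, v \in U by apply/card_gt0P; apply: leq_trans WU.
case: (@arg_maxnP _ v0 [pred v | v \in U] (fun v => #|nb U G v|) v0U) => v /= vU vmax.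
have kv : k.+1 <= #|nb U G v|.
  have /card_gt0P[u] : 0 < #|[set u in U | k.+1 <= #|nb U G u|]| by apply: leq_trans kq.
  by rewrite inE => /andP[uU ku]; apply: leq_trans ku (vmax _ uU).
have [G1 [eG1 top]] := lay_off sG vU; have [sG1 _ dG1] := eG1.
have cUv : #|U :\ v| = #|W| + k.+1 - 2.
  by move: cU'; rewrite (cardsD1 v) vU; rewrite -?(cardsT W); clear; lia.
case: (IH k1 hypk V (U :\ v) G1 sG1 cUv) => [[G2 [C [eG2 CU cC cl]]]|]; last first.
  by right; apply: has_anticopy_lift eG1 b => //; apply: subsetDl.
have setE (P : nat -> bool) : [set u in U | P #|nb U G1 u|] = [set u in U | P #|nb U G u|].
  by apply/setP=> u; rewrite !inE; case: (boolP (u \in U)) => //= uU; rewrite dG1.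
have [|||hc|[e [ev ce cE]]] := @extend_clique _ U C G1 G2 v k.+1 sG1 vU _ _ _ eG2 CU cC cl.
- by move=> x xU; rewrite !dG1 //; apply: vmax.
- move=> x y xN yU yN yv; have xU : x \in U by move: xN; rewrite inE => /andP[].
  by rewrite !dG1 //; apply: top.
- by rewrite dG1.
- by left; apply: has_clique_lift eG1 hc.
rewrite (setE (fun n => e < n)) in ce; rewrite (setE (fun n => e <= n)) in cE.
rewrite dG1 // in ev cE.
(* Otherwise the more than [k.+1] vertices counted by [q] would all have degree above [e], against
   [ce]. *)
have ke : k.+1 <= e.
  rewrite leqNgt; apply/negP => ek; move: kq; rewrite ltnNge => /negP; apply.
  apply: leq_trans ce; apply: subset_leq_card; apply/subsetP=> u; rewrite !inE.
  by case: (u \in U) => //=; apply: leq_trans.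
have [q2|q2] := leqP (2 * k.+2) #|[set u in U | k.+2 <= #|nb U G u| + 2]|.
  left; apply: (@potential_clique V U G k.+2 e #|nb U G v|) => //.
right.
have q2' : #|[set u in U | k.+1 <= #|nb U G u|.+1]| <= k.+1.*2.+1.
  have <- : [set u in U | k.+2 <= #|nb U G u| + 2] = [set u in U | k.+1 <= #|nb U G u|.+1].
    by apply/setP=> u; rewrite !inE addn2.
  by move: q2; rewrite -?(cardsT W); clear; lia.
have few : 7 * (k.+2 - 2) < #|W| -> leaves T <= k.+2 -> has_anticopy T U G.
  move=> kW lk; apply: (has_anticopy_few_leaves (k := k.+1) tT sG) => //.
    by move: kW; rewrite -?(cardsT W); clear; lia.
  move=> u uU; apply: leq_trans (_ : #|nb U G v| + 2 <= _); first by rewrite leq_add2r vmax.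
  apply: leq_trans cE _; apply: subset_leq_card; apply/subsetP=> x; rewrite !inE.
  by case: (x \in U) => //=; apply: leq_trans.
have [lk|kl] := leqP (leaves T) k.+2.
  by case: hyp => [h|/few]; [move: h; rewrite ltnNge lk | apply].
have W2 : 2 < #|W|.
  by have : leaves T <= #|W| := max_card _; move: kl; rewrite -?(cardsT W); clear; lia.
have [r dr] := exists_nonleaf tT W2.
(* At most [2 * k + 3] vertices have degree at least [k], so at least [#|W| - (k + 3)] hosts have
   complementary degree [#|W|] or more. As the root is no leaf, the [k + 3] or more leaves are all
   childless. *)
apply: (has_anticopy_dense (tau := #|W|) (r := r) tT sG) => // par dep rt.
have lc := leaves_childless sT rt dr.
have /= := card_deg_split U (fun u => #|nb U G u|.+1) k.+1.
have -> : [set u in U | #|nb U G u|.+1 < k.+1] = [set u in U | #|nb U G u| + #|W| < #|U|].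
  by apply/setP=> u; rewrite !inE cU'; case: (u \in U) => //=; apply/idP/idP; rewrite -?(cardsT W); clear; lia.
by move: q2' kl lc; rewrite cU'; rewrite -?(cardsT W); clear; lia.
Qed.

(** * Degree sequences *)

(** Allows a vertex set ['I_n] whose order only provably equals the length of the sequence, as for a
    complementary sequence. *)
Lemma potentially_graphicI (W : finType) (H : rel W) (pi : seq nat) (n : nat) (K : rel 'I_n) :
  n = size pi -> simple_graph K -> perm_eq pi (degseq K) -> contains_subgraph H K ->
  potentially_graphic H pi.
Proof. by move=> e; subst n => sK pK cK; exists K. Qed.

Lemma deg_nb (V : finType) (G : rel V) (v : V) : deg G v = #|nb [set: V] G v|.
Proof. by apply: eq_card => w; rewrite !inE. Qed.

Lemma equideg_degseq (n : nat) (G G' : rel 'I_n) :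
  equideg [set: 'I_n] G G' -> degseq G' = degseq G.
Proof. by move=> [_ _ dG]; apply: eq_map => v; rewrite !deg_nb dG. Qed.

Lemma degseq_compl_graph (n : nat) (G : rel 'I_n) :
  simple_graph G -> degseq (compl_graph G) = [seq n.-1 - d | d <- degseq G].
Proof.
move=> sG; rewrite /degseq -map_comp; apply: eq_map => v /=.
by rewrite !deg_nb nb_compl_graph ?inE // cardsT card_ord; clear; lia.
Qed.

Lemma rpot_upper (s t : nat) (T : rel 'I_t) :
  2 <= s -> is_tree T -> (s.+1 <= leaves T \/ 7 * (s - 2) < t) ->
  rpot_prop (complete_graph s) T (t + s - 2).
Proof.
move=> s2 tT hyp pi spi _ [G [sG pG]].
have hyp' : s.+1 <= leaves T \/ 7 * (s - 2) < #|'I_t| by rewrite card_ord.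
have cU : #|[set: 'I_(size pi)]| = #|'I_t| + s - 2 by rewrite cardsT !card_ord.
case: (clique_or_anticopy tT s2 hyp' sG cU) => [[G' [C [eG _ cC cl]]]|[G' [phi [eG inj _ edge]]]].
  left; have [sG' _ _] := eG; exists G'; split; first by split; rewrite ?(equideg_degseq eG).
  exists (fun i => enum_val (cast_ord (esym cC) i)); split.
    by move=> i j /enum_val_inj/cast_ord_inj.
  move=> i j ij; apply: cl; rewrite ?enum_valP //.
  by apply: contra ij => /eqP/enum_val_inj/cast_ord_inj ->.
right; have [sG' _ _] := eG.
apply: (@potentially_graphicI _ _ _ (size pi) (compl_graph G')).
- by rewrite size_map size_rev.
- exact: compl_graph_simple.
- rewrite degseq_compl_graph // (equideg_degseq eG) /compl_seq.
  by apply: perm_map; rewrite perm_rev.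
exists phi; split=> // x y xy; rewrite /compl_graph edge // andbT.
have [_ [[_ iT] _]] := tT.
by apply: contraTneq xy => /inj ->; rewrite iT.
Qed.

(** * The lower bound, by counting large degrees *)

Lemma count_degseq (n : nat) (G : rel 'I_n) (P : pred nat) :
  count P (degseq G) = #|[set v | P (deg G v)]|.
Proof.
rewrite count_map -sum1_count big_enum_cond /= -sum1_card.
by apply: eq_bigl => v; rewrite inE.
Qed.

Lemma card_ord_lt (n m : nat) : #|[set v : 'I_n | v < m]| = minn n m.
Proof.
have [le|lt] := leqP m n.
  rewrite -sum1_card (eq_bigl (fun v : 'I_n => v < m)); last by move=> v; rewrite inE.
  by rewrite (big_ord_narrow le) sum1_card card_ord.
rewrite -[RHS]card_ord -cardsT; apply: eq_card => v; rewrite !inE.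
by apply: ltn_trans lt.
Qed.

Definition split_graph (n m : nat) : rel 'I_n := fun i j => (i != j) && ((i < m) || (j < m)).
Arguments split_graph n m : clear implicits.

Lemma split_graph_simple (n m : nat) : simple_graph (split_graph n m).
Proof.
by split=> [i j|i]; rewrite /split_graph ?eqxx // eq_sym orbC.
Qed.

Lemma deg_split_graph_low (n m : nat) (i : 'I_n) : m <= i -> deg (split_graph n m) i <= m.
Proof.
move=> mi; apply: leq_trans (geq_minr n m); rewrite -card_ord_lt; apply: subset_leq_card.
by apply/subsetP=> j; rewrite !inE /split_graph ltnNge mi /= => /andP[].
Qed.

Lemma deg_split_graph_high (n m : nat) (i : 'I_n) : i < m -> deg (split_graph n m) i = n.-1.
Proof.
move=> im; rewrite -[in RHS](card_ord n) -(cardsC1 i); apply: eq_card => j.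
by rewrite !inE /split_graph im andbT eq_sym.
Qed.

(** Only degrees matter, so all realizations are excluded at once. A copy of [K_s] needs [s]
    vertices of degree at least [s - 1], but there are at most [s - 2]; a copy of the tree needs [t]
    vertices of positive complementary degree, but there are at most [N - (s - 2)], fewer than
    [t]. *)
Lemma rpot_lower (s t N : nat) (T : rel 'I_t) :
  2 <= s -> is_tree T -> (s.+1 <= leaves T \/ 7 * (s - 2) < t) -> N < t + s - 2 ->
  ~ rpot_prop (complete_graph s) T N.
Proof.
move=> s2 tT hyp Nts; have [t0 [[sT iT] [cT _]]] := tT; rewrite card_ord in t0.
pose G0 := split_graph N (s - 2); pose pi := sort geq (degseq G0).
have spi : size pi = N by rewrite size_sort size_map size_enum_ord.
have ppi : perm_eq pi (degseq G0) by rewrite perm_sort.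
have gpi : graphic pi.
  have H n : n = N -> size pi = n -> exists G : rel 'I_n, simple_graph G /\ perm_eq pi (degseq G).
    by move=> -> _; exists G0; split=> //; apply: split_graph_simple.
  exact: H spi erefl.
have srt : sorted geq pi by apply: sort_sorted => x y; apply: leq_total.
case/(_ pi spi srt gpi) => -[G [[[sG iG] pG] [f [inj edge]]]].
  have : count (leq s.-1) pi <= s - 2.
    rewrite (permP ppi) count_degseq; apply: leq_trans (geq_minr N (s - 2)).
    rewrite -card_ord_lt; apply: subset_leq_card; apply/subsetP=> v; rewrite !inE => le.
    rewrite ltnNge; apply/negP => /deg_split_graph_low; move: le; rewrite -/G0 -subn1.
    by move: s2; clear; lia.
  rewrite (permP pG) count_degseq leqNgt => /negP; apply.
  apply: (@leq_trans s); first by move: s2; clear; lia.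
  rewrite -[s in s <= _]card_ord -(card_codom inj); apply: subset_leq_card.
  apply/subsetP=> v /codomP[i ->]; rewrite inE -[s in s.-1]card_ord -(cardsC1 i).
  rewrite -(card_imset _ inj); apply: subset_leq_card; apply/subsetP=> w /imsetP[j ji ->].
  by rewrite inE; apply: edge; move: ji; rewrite !inE /complete_graph eq_sym.
have sz : size (compl_seq pi) = N by rewrite size_map size_rev.
have tN : t <= N.
  by have := leq_card f inj; rewrite !card_ord sz.
(* A single vertex has no positive degree. For [t = 1] the leaf condition fails, and the other
   condition gives [s = 2], hence [N < t]. *)
have [t1|t1] := leqP t 1.
  case: hyp => h; last by move: h Nts tN t1 s2; clear; lia.
  by have : leaves T <= #|'I_t| := max_card _; rewrite card_ord; move: h t1 s2; clear; lia.
have : count (fun d => 0 < d) (compl_seq pi) <= N - (s - 2).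
  rewrite count_map count_rev (permP ppi) count_degseq.
  have -> : N - (s - 2) = #|~: [set v : 'I_N | v < s - 2]|.
    by rewrite cardsCs setCK card_ord_lt card_ord; clear; lia.
  apply: subset_leq_card; apply/subsetP=> v; rewrite !inE /= spi subn_gt0 => lt.
  by apply/negP => /deg_split_graph_high e; move: lt; rewrite -/G0 e ltnn.
rewrite (permP pG) count_degseq leqNgt => /negP; apply.
apply: (@leq_trans t); first by move: Nts s2 t0 tN; clear; lia.
rewrite -[t in t <= _]card_ord -(card_codom inj); apply: subset_leq_card.
apply/subsetP=> v /codomP[i ->]; rewrite inE.
have [j ij] : exists j : 'I_t, j != i.
  apply/existsP; rewrite -[[exists _, _]]negbK negb_exists; apply/negP => /forallP all.
  move: t1; rewrite -[t in 1 < t]card_ord ltnNge => /negP; apply.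
  by apply/card_le1_eqP => x y _ _; have := all x; have := all y; rewrite !negbK => /eqP -> /eqP ->.
have /connectP[p pp jl] := cT i j.
case: p pp jl => [_ e|k p /= /andP[ik _] _]; first by rewrite e eqxx in ij.
by apply/card_gt0P; exists (f k); rewrite inE; apply: edge.
Qed.

Theorem theorem6 (s t : nat) (T : rel 'I_t) :
  2 <= s -> is_tree T ->
  (s.+1 <= leaves T \/ 7 * (s - 2) < t) ->
  rpot_eq (complete_graph s) T (t + s - 2).
Proof.
move=> s2 tT hyp; split; first exact: rpot_upper.
by move=> N; apply: rpot_lower.
Qed.
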